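(* Let $n\ge 2$, $1\le k\le n-1$, and let $\mathcal G_h$ be a simplicial subdivision of $\Omega$. Then $$\{\mu_h\in \mathbf V_h\Lambda^k:\ d^k_h\mu_h=0\ \text{and}\ \delta_{k,h}\mu_h=0\}=\mathfrak H_h\Lambda^k .$$
   Context: Setting. $\Omega\subset\mathbb R^n$ is a bounded Lipschitz domain, $\mathcal G_h$ a simplicial subdivision of it. $d^k$ is the exterior derivative on $k$-forms, $\star$ the Hodge star, and $\delta_k$ (mapping $k$-forms to $(k-1)$-forms) the codifferential, i.e. the formal $L^2$-adjoint of $d^{k-1}$: $\delta_k=(-1)^{n(k+1)+1}\star d^{n-k}\star$. $d^k_h$ and $\delta_{k,h}$ denote the operators applied cell by cell on $\mathcal G_h$. $H\Lambda^k=\{\omega\in L^2\Lambda^k(\Omega): d^k\omega\in L^2\Lambda^{k+1}(\Omega)\}$. Polynomial spaces on a simplex $T$. $\mathcal P_0\Lambda^k(T)$: constant-coefficient $k$-forms. The Koszul operator is $\kappa(dx^{\alpha_1}\wedge\dots\wedge dx^{\alpha_k})=\sum_{j=1}^k(-1)^{j+1}x^{\alpha_j}dx^{\alpha_1}\wedge\dots\wedge dx^{\alpha_{j-1}}\wedge dx^{\alpha_{j+1}}\wedge\dots\wedge dx^{\alpha_k}$ (extended linearly). Let $\tilde x^j=x^j-c_j$ with constants $c_j$ such that $\int_T\tilde x^j=0$; $\kappa_T$ is defined as $\kappa$ with $x^j$ replaced by $\tilde x^j$, and $\kappa_T^\delta=\star\kappa_T\star$. Set $\mathcal P_1^-\Lambda^k(T)=\mathcal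 P_0\Lambda^k(T)+\kappa(\mathcal P_0\Lambda^{k+1}(T))$ (Whitney forms) and $\mathcal P_1^{*,-}\Lambda^k(T)=\star\mathcal P_1^-\Lambda^{n-k}(T)$. For an increasing multi-index $\alpha=(\alpha_1<\dots<\alpha_k)$ in $\{1,\dots,n\}$ with complementary increasing multi-index $\alpha^{\mathsf C}$, and $dx^\alpha=dx^{\alpha_1}\wedge\dots\wedge dx^{\alpha_k}$, let $\tilde\mu^\alpha_{\delta,T}=\sum_{j=1}^k[(\tilde x^{\alpha_j})^2-c^{\alpha_j}]dx^\alpha$, $\tilde\mu^\alpha_{d,T}=\sum_{j=1}^{n-k}[(\tilde x^{\alpha^{\mathsf C}_j})^2-c^{\alpha^{\mathsf C}_j}]dx^\alpha$, where the constants $c^i$ are such that $\int_T[(\tilde x^i)^2-c^i]=0$, and $\tilde\mu^\alpha_{d\cap\delta,T}=-\frac{k}{n-k}\tilde\mu^\alpha_{d,T}+\tilde\mu^\alpha_{\delta,T}$. The enriched space is $$\mathbf P_{d\cap\delta}\Lambda^k(T)=\mathcal P_0\Lambda^k(T)\oplus\kappa_T(\mathcal P_0\Lambda^{k+1}(T))\oplus\kappa_T^\delta(\mathcal P_0\Lambda^{k-1}(T))\oplus\mathrm{span}\{\tilde\mu^\alpha_{d\cap\delta,T}\}_\alpha .$$ For any of these local spaces, writing $\mathcal G_h$ in place of $T$ denotes the space of piecewise functions (no inter-cell continuity) whose restriction to each $T\in\mathcal G_h$ lies in the local space. Global spaces. $\mathbf W_h\Lambda^k=\mathcal P_1^-\Lambda^k(\mathcal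 G_h)\cap H\Lambda^k$; $\mathbf W^{*,\rm nc}_{h0}\Lambda^k=\{\mu_h\in\mathcal P_1^{*,-}\Lambda^k(\mathcal G_h):\langle\delta_{k,h}\mu_h,\tau_h\rangle_{L^2\Lambda^{k-1}}=\langle\mu_h,d^{k-1}\tau_h\rangle_{L^2\Lambda^k}\ \forall\tau_h\in\mathbf W_h\Lambda^{k-1}\}$; $\mathbf V_h\Lambda^k=\{\mu_h\in\mathbf P_{d\cap\delta}\Lambda^k(\mathcal G_h):\langle d^k_h\mu_h,\eta_h\rangle_{L^2\Lambda^{k+1}}=\langle\mu_h,\delta_{k+1,h}\eta_h\rangle_{L^2\Lambda^k}\ \forall\eta_h\in\mathbf W^{*,\rm nc}_{h0}\Lambda^{k+1},\ \text{and}\ \langle\delta_{k,h}\mu_h,\tau_h\rangle_{L^2\Lambda^{k-1}}=\langle\mu_h,d^{k-1}\tau_h\rangle_{L^2\Lambda^k}\ \forall\tau_h\in\mathbf W_h\Lambda^{k-1}\}$. Discrete harmonic forms: $\mathfrak H_h\Lambda^k$ is the $L^2$-orthogonal complement of $d^{k-1}(\mathbf W_h\Lambda^{k-1})$ in $\{\mu_h\in\mathbf W_h\Lambda^k:d^k\mu_h=0\}$. *)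

(* Defs.v *)
From HB Require Import structures.
From mathcomp Require Import all_boot all_order all_algebra finmap.
From mathcomp Require Import all_classical all_reals all_analysis.

Set Implicit Arguments.
Unset Strict Implicit.
Unset Printing Implicit Defensive.

Import Order.TTheory GRing.Theory Num.Theory.
Import numFieldNormedType.Exports.

Local Open Scope classical_set_scope.
Local Open Scope ring_scope.

(** [lebesgue_tuple n] is n-dimensional Lebesgue measure, obtained by iterating
    the binary product on [n.-tuple R], which carries the product
    sigma-algebra; points of ['rV[R]_n] are reached through the bijection
    [rV_of_tuple]. *)

Section tuple_measure.
Variable R : realType.
Let T := measurableTypeR R.

Definition tcons n (p : T * n.-tuple T) : n.+1.-tuple T := [tuple of p.1 :: p.2].

Lemma measurable_tcons n : measurable_fun [set: T * n.-tuple T] (@tcons n).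
Proof.
by apply: measurable_cons; [exact: measurable_fst|exact: measurable_snd].
Qed.

Section step.
Variables (n : nat) (mu : {sigma_finite_measure set (n.-tuple T) -> \bar R}).

Definition lebesgue_cons : set (n.+1.-tuple T) -> \bar R :=
  pushforward (lebesgue_measure \x mu)%E (@tcons n).

Let lebesgue_cons0 : lebesgue_cons set0 = 0%E.
Proof. by rewrite /lebesgue_cons /pushforward preimage_set0 measure0. Qed.

Let lebesgue_cons_ge0 A : (0 <= lebesgue_cons A)%E.
Proof. by apply: integral_ge0 => x _; exact: measure_ge0. Qed.

Let lebesgue_cons_sigma_additive : semi_sigma_additive lebesgue_cons.
Proof.
move=> F mF tF mUF; rewrite /lebesgue_cons /pushforward preimage_bigcup.
have mp (A : set (n.+1.-tuple T)) : measurable A -> measurable (@tcons n @^-1` A).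
  by move=> mA; rewrite -[X in measurable X]setTI; exact: measurable_tcons.
apply: measure_semi_sigma_additive; first by move=> i; exact: mp.
- apply/trivIsetP => /= i j _ _ ij; rewrite -preimage_setI.
  by move/trivIsetP : tF => /(_ _ _ _ _ ij) ->//; rewrite preimage_set0.
- by rewrite -preimage_bigcup; exact: mp.
Qed.

HB.instance Definition _ := isMeasure.Build _ _ _ lebesgue_cons
  lebesgue_cons0 lebesgue_cons_ge0 lebesgue_cons_sigma_additive.

Let lebesgue_cons_sigma_finite : sigma_finite setT lebesgue_cons.
Proof.
have /sigma_finiteP[F [FT ndF Foo]] := sigma_finiteT (@lebesgue_measure R).
have /sigma_finiteP[E [ET ndE Eoo]] := sigma_finiteT mu.
pose u (t : n.+1.-tuple T) : T * n.-tuple T := (thead t, [tuple of behead t]).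
have tuK (p : T * n.-tuple T) : u (tcons p) = p.
  by case: p => x t; rewrite /u /tcons /= (_ : [tuple of _] = t)//; exact/val_inj.
have u_meas : measurable_fun [set: n.+1.-tuple T] u.
  apply: measurable_fun_pair; last exact: measurable_behead.
  exact: (measurable_tnth ord0).
exists (fun i => u @^-1` (F i `*` E i)).
  rewrite -preimage_bigcup (_ : \bigcup_i _ = setT) ?preimage_setT//.
  apply/seteqP; split=> // -[x t] _.
  have [i _ Fix] : (\bigcup_i F i) x by rewrite -FT.
  have [j _ Ejt] : (\bigcup_i E i) t by rewrite -ET.
  exists (maxn i j) => //; split => /=.
    by move: x Fix; exact/subsetPset/ndF/leq_maxl.
  by move: t Ejt; exact/subsetPset/ndE/leq_maxr.
move=> i; have [mF F_oo] := Foo i; have [mE E_oo] := Eoo i; split.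
  by rewrite -[X in measurable X]setTI; apply: u_meas => //; exact: measurableX.
rewrite /lebesgue_cons /pushforward (_ : _ @^-1` _ = F i `*` E i); last first.
  by rewrite -comp_preimage (_ : u \o @tcons n = id)//; exact/funext.
by rewrite product_measure1E// lte_mul_pinfty// ge0_fin_numE.
Qed.

HB.instance Definition _ := Measure_isSigmaFinite.Build _ _ _ lebesgue_cons
  lebesgue_cons_sigma_finite.

End step.

Let t0 : 0.-tuple T := [tuple].

Let dirac0_sigma_finite : sigma_finite setT (dirac t0 : set (0.-tuple T) -> \bar R).
Proof.
exists (fun=> setT); first by rewrite bigcup_const//; exists 0%N.
by move=> i; split => //; rewrite diracT ltry.
Qed.

Definition lebesgue_nil : set (0.-tuple T) -> \bar R := dirac t0.
HB.instance Definition _ := Measure.on lebesgue_nil.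
HB.instance Definition _ := Measure_isSigmaFinite.Build _ _ _ lebesgue_nil
  dirac0_sigma_finite.

Fixpoint lebesgue_tuple n : {sigma_finite_measure set (n.-tuple T) -> \bar R} :=
  match n with
  | 0 => lebesgue_nil
  | m.+1 => lebesgue_cons (lebesgue_tuple m)
  end.

End tuple_measure.

Section geometry.
Variables (R : realType) (n : nat).
Implicit Types (D Omega : set 'rV[R]_n) (T : {fset 'rV[R]_n}).

Definition rV_of_tuple (t : n.-tuple (measurableTypeR R)) : 'rV[R]_n :=
  \row_i tnth t i.

Definition integral_rV D (f : 'rV[R]_n -> R) : R :=
  \int[lebesgue_tuple R n]_(t in rV_of_tuple @^-1` D) f (rV_of_tuple t).

(** Near each boundary point, in a suitable orthonormal coordinate system
    [y *m Q] with one coordinate [i] singled out, the domain is the part of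
    space above the graph of a Lipschitz function of the other coordinates. *)
Definition bounded_lipschitz_domain Omega : Prop :=
  [/\ open Omega, connected Omega, Omega !=set0, bounded_set Omega &
    forall x, closure Omega x -> ~ Omega x ->
    exists (Q : 'M[R]_n) (i : 'I_n) (gamma : 'rV[R]_n.-1 -> R) (L : R),
    [/\ Q *m Q^T = 1%:M, L.-lipschitz gamma &
      \forall y \near x,
        Omega y <-> gamma (col' i (y *m Q)) < (y *m Q) ord0 i]].

Definition hull T : set 'rV[R]_n :=
  [set x | exists w : 'rV[R]_n -> R,
    [/\ forall v, v \in T -> 0 <= w v, \sum_(v <- T) w v = 1 &
        x = \sum_(v <- T) w v *: v]].

(** A simplex is represented by its set of vertices, so that the face common to
    two cells is spanned by the intersection of their vertex sets. *)
Definition is_simplex T : Prop :=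
  #|` T| = n.+1 /\
  forall w : 'rV[R]_n -> R, \sum_(v <- T) w v = 0 ->
    \sum_(v <- T) w v *: v = 0 -> forall v, v \in T -> w v = 0.

Definition simplicial_subdivision Omega (G : {fset {fset 'rV[R]_n}}) : Prop :=
  [/\ forall T, T \in G -> is_simplex T,
      closure Omega = \bigcup_(T in [set` G]) hull T &
      forall S T, S \in G -> T \in G ->
        hull S `&` hull T = hull (S `&` T)%fset].

End geometry.

(** A form of arbitrary (possibly mixed) degree is given by its coefficients:
    [omega x A] is the coefficient at [x] of
    [dx^A = dx^{a_1} /\ ... /\ dx^{a_k}], where [A = {a_1 < ... < a_k}]. *)

Definition dform (R : realType) (n : nat) := 'rV[R]_n -> {set 'I_n} -> R.

Section forms.
Variables (R : realType) (n : nat).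
Implicit Types (k : nat) (omega eta mu tau phi : dform R n) (A B : {set 'I_n}).

Definition kform k omega : Prop := forall x A, #|A| != k -> omega x A = 0.

Definition dx A : {set 'I_n} -> R := fun B => (B == A)%:R.

(** [dx^i /\ dx^A = (-1)^(before i A) dx^(i |: A)] when [i] is not in [A]. *)
Definition before (i : 'I_n) A : nat := #|[pred j in A | (j < i)%N]|.

(** [dx^A /\ dx^(~: A) = (-1)^(inversions A) dx^1 /\ ... /\ dx^n] *)
Definition inversions A : nat :=
  #|[pred p : 'I_n * 'I_n | [&& p.1 \in A, p.2 \notin A & (p.2 < p.1)%N]]|.

Definition partial (i : 'I_n) (f : 'rV[R]_n -> R) : 'rV[R]_n -> R :=
  fun x => 'D_('e_i) f x.

Definition extd omega : dform R n := fun x B =>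
  \sum_(A : {set 'I_n}) \sum_(i | i \notin A)
    partial i (omega ^~ A) x * (-1) ^+ before i A * dx (i |: A) B.

Definition hodge omega : dform R n := fun x B =>
  \sum_(A : {set 'I_n}) omega x A * (-1) ^+ inversions A * dx (~: A) B.

Definition codiff k omega : dform R n := fun x B =>
  (-1) ^+ (n * k.+1 + 1)%N * hodge (extd (hodge omega)) x B.

(** The Koszul operator with [x^i] replaced by [x^i - c_i]. *)
Definition koszul (c : 'rV[R]_n) omega : dform R n := fun x B =>
  \sum_(A : {set 'I_n}) omega x A *
    \sum_(i in A) (-1) ^+ before i A * (x - c) ord0 i * dx (A :\ i) B.

Definition dotf omega eta : 'rV[R]_n -> R := fun x =>
  \sum_(A : {set 'I_n}) omega x A * eta x A.

(** Elements of the L2 spaces below are representatives: functions on the whole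
    of R^n whose values outside [Omega] are irrelevant. *)

Section L2.
Variable Omega : set 'rV[R]_n.
Let mOmega := @rV_of_tuple R n @^-1` Omega.

Definition L2form k : set (dform R n) :=
  [set omega | kform k omega /\ forall A,
    measurable_fun mOmega (fun t => omega (rV_of_tuple t) A) /\
    (lebesgue_tuple R n).-integrable mOmega
      (fun t => (omega (rV_of_tuple t) A ^+ 2)%:E)].

Definition dotL2 omega eta : R := integral_rV Omega (dotf omega eta).

Definition smooth (f : 'rV[R]_n -> R) : Prop :=
  forall s : seq 'I_n, let g := foldr partial f s in
    continuous g /\ forall x i, derivable g x 'e_i.

Definition test_form k : set (dform R n) :=
  [set phi | let S := closure [set x | exists A, phi x A != 0] in
    [/\ kform k phi, forall A, smooth (phi ^~ A), compact S & S `<=` Omega]].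

(** Since [phi] is smooth with compact support in [Omega], this says that [eta]
    is the distributional exterior derivative of [omega]. *)
Definition weak_extd k omega eta : Prop :=
  [/\ L2form k omega, L2form k.+1 eta &
    forall phi, test_form k.+1 phi ->
      dotL2 eta phi = dotL2 omega (codiff k.+1 phi)].

Definition HLambda k : set (dform R n) :=
  [set omega | exists eta, weak_extd k omega eta].

End L2.

Definition P0 k : set (dform R n) :=
  [set omega | kform k omega /\ exists a, omega = fun=> a].

Definition P1minus k : set (dform R n) :=
  [set omega + eta | omega in P0 k & eta in koszul 0 @` P0 k.+1].

Definition P1starminus k : set (dform R n) := hodge @` P1minus (n - k).

Section local_spaces.
Variable T : {fset 'rV[R]_n}.

Definition mean (f : 'rV[R]_n -> R) : R :=
  integral_rV (hull T) f / integral_rV (hull T) (fun=> 1).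

(** The constants with [\int_T (x^i - c_i) = 0] and
    [\int_T ((x^i - c_i)^2 - m_i) = 0]. *)
Definition barycenter : 'rV[R]_n := \row_i mean (fun x => x ord0 i).

Definition moment (i : 'I_n) : R := mean (fun x => (x - barycenter) ord0 i ^+ 2).

Definition bubble (I A : {set 'I_n}) : dform R n := fun x B =>
  (\sum_(i in I) ((x - barycenter) ord0 i ^+ 2 - moment i)) * dx A B.

Definition mu_delta A : dform R n := bubble A A.
Definition mu_d A : dform R n := bubble (~: A) A.
Definition mu_d_delta k A : dform R n := fun x B =>
  - (k%:R / (n - k)%N%:R) * mu_d A x B + mu_delta A x B.

Definition koszul_delta omega : dform R n := hodge (koszul barycenter (hodge omega)).

Definition Pddelta k : set (dform R n) :=
  [set omega | exists p a b (s : {set 'I_n} -> R),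
    [/\ P0 k p, P0 k.+1 a, P0 k.-1 b &
      omega = p + koszul barycenter a + koszul_delta b +
        (fun x B => \sum_(A : {set 'I_n} | #|A| == k) s A * mu_d_delta k A x B)]].

End local_spaces.

Section global_spaces.
Variables (Omega : set 'rV[R]_n) (G : {fset {fset 'rV[R]_n}}).

Definition cells : set 'rV[R]_n := \bigcup_(T in [set` G]) interior (hull T).

(** Membership constrains the values inside the cells only: the skeleton is a
    null set. *)
Definition piecewise k (P : {fset 'rV[R]_n} -> set (dform R n)) : set (dform R n) :=
  [set mu | L2form Omega k mu /\ forall T, T \in G ->
    exists2 p, P T p & forall x, interior (hull T) x -> mu x = p x].

(** Inside a cell an element of a piecewise space is a polynomial, so the
    classical derivatives taken there are the cell-by-cell operators. *)
Definition extd_h mu : dform R n := patch (fun=> 0) cells (extd mu).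
Definition codiff_h k mu : dform R n := patch (fun=> 0) cells (codiff k mu).

Definition Wh k : set (dform R n) :=
  piecewise k (fun=> P1minus k) `&` HLambda Omega k.

Definition Wh_star_nc k : set (dform R n) :=
  [set mu | piecewise k (fun=> P1starminus k) mu /\
    forall tau dtau, Wh k.-1 tau -> weak_extd Omega k.-1 tau dtau ->
      dotL2 Omega (codiff_h k mu) tau = dotL2 Omega mu dtau].

Definition Vh k : set (dform R n) :=
  [set mu | [/\ piecewise k (Pddelta ^~ k) mu,
    forall eta, Wh_star_nc k.+1 eta ->
      dotL2 Omega (extd_h mu) eta = dotL2 Omega mu (codiff_h k.+1 eta) &
    forall tau dtau, Wh k.-1 tau -> weak_extd Omega k.-1 tau dtau ->
      dotL2 Omega (codiff_h k mu) tau = dotL2 Omega mu dtau]].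

Definition harmonic_h k : set (dform R n) :=
  [set mu | [/\ Wh k mu, weak_extd Omega k mu 0 &
    forall tau dtau, Wh k.-1 tau -> weak_extd Omega k.-1 tau dtau ->
      dotL2 Omega mu dtau = 0]].

End global_spaces.

End forms.

(* Main.v *)
Require Import Defs.
From mathcomp Require Import all_boot all_order all_algebra finmap.
From mathcomp Require Import all_classical all_reals all_analysis measurable_realfun.
From mathcomp Require Import lra ring zify.

Set Implicit Arguments.
Unset Strict Implicit.
Unset Printing Implicit Defensive.

Import Order.TTheory GRing.Theory Num.Theory.
Import numFieldNormedType.Exports.

Local Open Scope classical_set_scope.
Local Open Scope ring_scope.

(** Both sides consist of piecewise constant forms, and on such forms the two
    notions of conformity, the nonconforming one of [Vh] and membership in
    [HLambda], coincide.

    On a cell T an element of the enriched space reads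
    p + kappa_T a + kappa_T^delta b + sum_A s_A mu^A with constant p, a, b.  Its
    exterior derivative is a multiple of a plus a linear part in which each s_A
    is, up to a nonzero factor, the coefficient of some monomial, so closedness
    gives s = 0 and a = 0, after which coclosedness gives b = 0
    ([Pddelta_harmonic_cst]).  In the same way a closed Whitney form
    p + kappa_T a is constant ([weak_closed_cst]).  For forms that are closed and
    coclosed cell by cell, the condition against [d W_h] is literally the
    orthogonality in the definition of the discrete harmonic forms.

    It remains to compare the conditions against the nonconforming star
    space [Wh_star_nc].  Let B(mu, eta) = <d_h mu, eta> - <mu, delta_h eta>.  That
    space is the annihilator of [W_h] under B, which gives at once the inclusion
    of the harmonic forms in [Vh] ([harmonic_sub_Vh]).  Conversely let mu be
    piecewise constant and annihilated by the star space; the claim is that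
    <mu, delta phi> = 0 for every test form phi.  On one cell B pairs Whitney
    forms and star Whitney forms nondegenerately, because constants are
    orthogonal to Koszul forms based at the barycenter.  Hence there is a star
    Whitney form eta_T with B_T(p, eta_T) = B_T(p, phi) for all Whitney forms p
    ([cell_interpolant]).  Glued over the cells these give an element eta of the
    star space, because B(tau, phi) = 0 for tau in [W_h] by definition of the
    weak derivative, and so <mu, delta phi> = - B(mu, phi) = - B(mu, eta) = 0
    ([star_interpolant]).

    This argument pairs weak derivatives with forms, such as eta, that do not
    vanish near the boundary of a cell.  That the weak derivative of a piecewise
    polynomial can be replaced by its classical derivative in such pairings is
    [weak_extd_cell]: multiply by smooth cut-offs built from barycentric
    coordinates, integrate by parts ([integral_partial]) and let the cut-offs
    increase to 1.  Integrals over the domain split into integrals over the open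
    cells ([integral_mesh]), since the cells are disjoint, their boundaries lie
    in hyperplanes, and they are contained in the domain, which is the interior
    of its closure ([interior_closure_lipschitz]). *)

(** * Lebesgue measure on tuples *)

Section tuple_space.
Variable R : realType.
Implicit Types n : nat.

Definition open_box n (x : 'I_n -> R) (e : R) : set (n.-tuple (measurableTypeR R)) :=
  [set t | forall i, `|x i - tnth t i| < e].

Lemma measurable_open_box n (x : 'I_n -> R) e : measurable (open_box x e).
Proof.
have -> : open_box x e = \bigcap_(i in [set: 'I_n])
    ((@tnth n (measurableTypeR R))^~ i @^-1` ball (x i : R) e).
  by apply/seteqP; split => t /= h i; [move=> _; exact: h|exact: h].
apply: fin_bigcap_measurable => // i _.
rewrite -[X in measurable X]setTI; apply: measurable_tnth => //.
by rewrite ball_itv; exact: measurable_itv.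
Qed.

(** An open set is the union of the boxes with rational center and radius 1/(m+1)
    that it contains, and there are countably many of these. *)
Lemma measurable_open_rV n (O : set 'rV[R]_n) : open O ->
  measurable (@rV_of_tuple R n @^-1` O).
Proof.
move=> oO.
pose c (q : 'rV[rat]_n * nat) : 'I_n -> R := fun i => ratr (q.1 ord0 i).
pose F (q : 'rV[rat]_n * nat) := if `[< open_box (c q) q.2.+1%:R^-1 `<=`
   @rV_of_tuple R n @^-1` O >] then open_box (c q) q.2.+1%:R^-1 else set0.
rewrite (_ : _ @^-1` _ = \bigcup_q F q); last first.
  apply/seteqP; split => [t /= Ot|t [q _]]; last first.
    by rewrite /F; case: asboolP => // sub /sub.
  have /nbhs_ballP [e /= e0 be] : nbhs (rV_of_tuple t) O by exact: open_nbhs_nbhs.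
  (* The radius is below e / 2, so that a box around a rational point near t is
     contained in the ball of radius e around t. *)
  have [m me] : exists m : nat, m.+1%:R^-1 < e / 2.
    have := @cvg_harmonic R => /cvgrPdist_lt /(_ (e / 2)).
    rewrite divr_gt0// => /(_ isT) [N _ /(_ N (leqnn _))] /=.
    by rewrite sub0r normrN ger0_norm//; exists N.
  have /choice [q qP] : forall i : 'I_n, exists q : rat,
      (ratr q : R) \in `](tnth t i - m.+1%:R^-1), (tnth t i + m.+1%:R^-1)[.
    move=> i; have : tnth t i - m.+1%:R^-1 < tnth t i + m.+1%:R^-1 :> R.
      by rewrite ltrBlDr -addrA ltrDl addr_gt0// invr_gt0.
    by move=> /rat_in_itvoo[q ?]; exists q.
  exists (\row_i q i, m) => //; rewrite /F; case: asboolP => [_|]; last first.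
    case=> s /= sP; apply: be; split => // i j; rewrite ord1 !mxE /ball/=.
    have := sP j; rewrite /c mxE => h1; have := qP j; rewrite in_itv/= => /andP[h2 h3].
    rewrite (splitr e) -(subrKA (ratr (q j))).
    apply: le_lt_trans (ler_normD _ _) _; apply: ltrD; last exact: lt_trans h1 me.
    by apply: lt_trans me; rewrite distrC ltr_distl; exact/andP.
  by move=> i; rewrite /c /= mxE ltr_distl; have := qP i; rewrite in_itv.
apply: countable_bigcupT_measurable => [|q]; first exact: countableP.
by rewrite /F; case: asboolP => // _; exact: measurable_open_box.
Qed.

Lemma measurable_fun_continuous_rV n (f : 'rV[R]_n -> R) : continuous f ->
  measurable_fun setT (fun t : n.-tuple (measurableTypeR R) => f (rV_of_tuple t)).
Proof.
move=> cf; apply: (measurability _ (RGenOpens.measurableE R)).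
move=> _ [_ [a [b ->] <-]]; rewrite setTI.
have -> : (fun t => f (rV_of_tuple t)) @^-1` `]a, b[%classic =
  @rV_of_tuple R n @^-1` (f @^-1` `]a, b[%classic) by [].
apply: measurable_open_rV; move/continuousP : cf; apply.
exact: interval_open.
Qed.

Local Open Scope ereal_scope.

Lemma lebesgue_tupleS n (A : set (n.+1.-tuple (measurableTypeR R))) :
  lebesgue_tuple R n.+1 A =
  (lebesgue_measure \x lebesgue_tuple R n) (@tcons R n @^-1` A).
Proof. by []. Qed.

Lemma lebesgue_tuple_slices n (A : set (n.+1.-tuple (measurableTypeR R))) :
  lebesgue_tuple R n.+1 A =
  \int[lebesgue_measure]_x (lebesgue_tuple R n) [set t | A (tcons (x, t))].
Proof.
rewrite lebesgue_tupleS /product_measure1.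
apply: eq_integral => x _ /=; congr (lebesgue_tuple R n _).
by apply/seteqP; split => t; rewrite /xsection/= inE.
Qed.

Lemma tnth_tcons_lift n x (t : n.-tuple (measurableTypeR R)) j :
  tnth (tcons (x, t)) (lift ord0 j) = tnth t j.
Proof. by rewrite !(tnth_nth 0%R). Qed.

Lemma sum_tcons n (a : 'I_n.+1 -> R) x (t : n.-tuple (measurableTypeR R)) :
  (\sum_i a i * tnth (tcons (x, t)) i = a ord0 * x + \sum_i a (lift ord0 i) * tnth t i)%R.
Proof.
rewrite big_ord_recl; congr (_ * _ + _)%R; apply: eq_bigr => i _.
by congr (_ * _)%R; rewrite !(tnth_nth 0%R).
Qed.

(** Slice along the first coordinate.  If some other coefficient is nonzero, all
    slices are hyperplanes of lower dimension; otherwise the hyperplane is a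
    point times the whole space. *)
Lemma null_hyperplane n (a : 'I_n -> R) (c : R) : (exists i, a i != 0%R) ->
  lebesgue_tuple R n [set t | \sum_i a i * tnth t i = c]%R = 0.
Proof.
elim: n => [|n IH] in a c * => -[i ai]; first by case: i ai.
have [[j aj]|na] := pselect (exists j, a (lift ord0 j) != 0%R).
  rewrite lebesgue_tuple_slices integral0_eq// => x _ /=.
  rewrite -(IH (fun j => a (lift ord0 j)) (c - a ord0 * x)%R); last by exists j.
  congr (lebesgue_tuple R n _); apply/seteqP; split => t /=; rewrite sum_tcons => h.
    by rewrite -h [RHS]addrAC subrr add0r.
  by rewrite h addrC subrK.
have a0 : a ord0 != 0%R.
  case: (unliftP ord0 i) ai => [j ->|-> //] aj; exfalso; apply: na; by exists j.
have aS j : a (lift ord0 j) = 0%R.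
  by apply/eqP/negP => /negP h; apply: na; exists j.
rewrite (_ : [set _ | _] = [set t | tnth t ord0 = c / a ord0]%R).
  rewrite lebesgue_tupleS (_ : _ @^-1` _ = [set c / a ord0]%R `*` setT).
    rewrite product_measure1E// (_ : (_ : set _ -> \bar R) [set _] = 0) ?mul0e//.
    exact: lebesgue_measure_set1.
  by apply/seteqP; split => -[x t] //= [].
apply/seteqP; split => t /=; rewrite (tuple_eta t) -/(tcons (thead t, _)) sum_tcons
   [X in (_ + X)%R]big1 ?addr0 => [h|j _]; rewrite ?aS ?mul0r//.
  by rewrite /= -h mulrAC divff// mul1r.
by have {}h : thead t = (c / a ord0)%R := h; rewrite h mulrC divfK.
Qed.

Lemma preimage_tcons_open_box n (x : 'I_n.+1 -> R) e :
  @tcons R n @^-1` open_box x e =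
  `](x ord0 - e)%R, (x ord0 + e)%R[%classic `*` open_box (fun i => x (lift ord0 i)) e.
Proof.
apply/seteqP; split => -[y t] /= h.
  split => [|i].
    by have := h ord0; rewrite distrC ltr_distl in_itv.
  by have := h (lift ord0 i); rewrite !(tnth_nth 0%R).
move=> i; case: (unliftP ord0 i) => [j ->|->].
  by have := h.2 j; rewrite !(tnth_nth 0%R).
by rewrite distrC ltr_distl; have := h.1; rewrite in_itv.
Qed.

Lemma measure_open_box n (x : 'I_n -> R) e : (0 < e)%R ->
  lebesgue_tuple R n (open_box x e) = ((2 * e) ^+ n)%:E.
Proof.
move=> e0; elim: n => [|n IH] in x *.
  rewrite /= /lebesgue_nil diracE expr0 mem_set//.
  by move=> [].
rewrite lebesgue_tupleS preimage_tcons_open_box product_measure1E//; last 1 first.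
  exact: measurable_open_box.
rewrite IH exprS EFinM; congr (_ * _); apply: eq_trans (lebesgue_measure_itv _) _.
rewrite /= lte_fin ltrD2l gt0_cp// -EFinD; congr EFin; ring.
Qed.

(** For a nonpositive radius the box is empty, except in dimension zero where it is
    the whole one-point space; both cases are covered by the box of radius 1. *)
Lemma open_box_lty n (M : R) :
  lebesgue_tuple R n (open_box (fun=> 0%R) M) < +oo.
Proof.
have [M0|M0] := ltP 0%R M; first by rewrite measure_open_box// ltry.
have : lebesgue_tuple R n (open_box (fun=> 0%R) M) <=
       lebesgue_tuple R n (open_box (fun=> 0%R) 1).
  apply: le_measure; rewrite ?inE; [exact: measurable_open_box..|].
  by move=> t h i; apply: lt_trans (h i) _; rewrite (le_lt_trans M0).
by move/le_lt_trans; apply; rewrite measure_open_box// ltry.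
Qed.

Lemma integrable_bounded_box n (g : n.-tuple (measurableTypeR R) -> R) M C :
  measurable_fun setT g -> (forall t, `|g t| <= C)%R ->
  (forall t, g t != 0%R -> forall j, `|tnth t j| < M)%R ->
  (lebesgue_tuple R n).-integrable setT (EFin \o g).
Proof.
move=> mg gC gM.
have gE : g = g \_ (open_box (fun=> 0%R) M).
  apply/funext => t; rewrite patchE; case: ifPn => //; apply: contraNeq => gt.
  by rewrite inE => i; rewrite sub0r normrN; exact: gM.
rewrite gE -restrict_EFin -integrable_mkcond; last exact: measurable_open_box.
apply: measurable_bounded_integrable.
- exact: measurable_open_box.
- exact: open_box_lty.
- exact: measurable_funTS.
- exists C; split; first exact: num_real.
  by move=> x Cx t _; exact: le_trans (gC t) (ltW Cx).
Qed.

Definition tset n (t : n.-tuple (measurableTypeR R)) (i : 'I_n) (x : R) :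
    n.-tuple (measurableTypeR R) :=
  [tuple if j == i then x else tnth t j | j < n].

Lemma tnth_tset n t (i : 'I_n) x j :
  tnth (tset t i x) j = if j == i then x else tnth t j.
Proof. by rewrite tnth_mktuple. Qed.

(** Fubini: a bounded function of bounded support whose integrals along all lines
    parallel to one axis vanish has integral zero.  Boundedness and bounded
    support, rather than integrability, pass to every slice in the induction. *)
Lemma integral0_lines n (i : 'I_n) (g : n.-tuple (measurableTypeR R) -> R) M C :
  measurable_fun setT g -> (forall t, `|g t| <= C)%R ->
  (forall t, g t != 0%R -> forall j, `|tnth t j| < M)%R ->
  (forall t, \int[lebesgue_measure]_x (g (tset t i x))%:E = 0) ->
  \int[lebesgue_tuple R n]_t (g t)%:E = 0.
Proof.
elim: n => [|n IH] in i g *; first by case: i.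
move=> mg gC gM g0.
have ig := integrable_bounded_box mg gC gM.
have mgc : measurable_fun setT (g \o @tcons R n).
  by apply: measurableT_comp => //; exact: measurable_tcons.
have igc : (lebesgue_measure \x lebesgue_tuple R n).-integrable setT
    (EFin \o g \o @tcons R n).
  have /integrableP[_] := ig.
  rewrite ge0_integral_pushforward//; last first.
    by apply: measurableT_comp => //; exact/measurable_EFinP.
    exact: measurable_tcons.
  move=> h; apply/integrableP; split => //.
  exact/measurable_EFinP.
rewrite (_ : \int[_]_t _ =
    \int[lebesgue_measure \x lebesgue_tuple R n]_p (g (tcons p))%:E); last first.
  rewrite integral_pushforward//; [exact: measurable_tcons|exact/measurable_EFinP].
(* For an axis other than the first the inner integral vanishes by induction;
   for the first axis the order of integration is exchanged. *)
case: (unliftP ord0 i) => [j ij|i0].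
  rewrite -integral12_prod_meas1//=; apply: integral0_eq => x _.
  apply: (IH j) => //.
  - by apply: (measurableT_comp mgc); exact: measurable_pair1.
  - move=> t gt k; have := gM _ gt (lift ord0 k).
    by rewrite tnth_tcons_lift.
  - move=> t; rewrite -[RHS](g0 (tcons (x, t))); apply: eq_integral => y _.
    congr (EFin (g _)); apply: eq_from_tnth => k.
    rewrite tnth_tset ij; case: (unliftP ord0 k) => [l ->|->].
      by rewrite (inj_eq lift_inj) !tnth_tcons_lift tnth_tset.
    by rewrite eq_sym.
rewrite -integral21_prod_meas1//=; apply: integral0_eq => t _.
rewrite -[RHS](g0 (tcons (0%R, t))); apply: eq_integral => y _.
congr (EFin (g _)); apply: eq_from_tnth => k.
rewrite tnth_tset i0; case: (unliftP ord0 k) => [l ->|->//].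
by rewrite !tnth_tcons_lift eq_sym.
Qed.

End tuple_space.

(** * Smooth functions and cut-off profiles *)

Section flat_function.
Variable R : realType.
Implicit Types (j : nat) (s : R).

(** For j = 0 this is the classical profile exp(-1/s), flat at the origin.  The
    family with the extra factor 1/s^j is closed under differentiation up to
    linear combinations, which makes smoothness provable for all j at once. *)
Definition flat j s : R := if 0 < s then s^-1 ^+ j * expR (- s^-1) else 0.

Lemma flat_ge0 j s : 0 <= flat j s.
Proof.
rewrite /flat; case: ifP => // s0.
by rewrite mulr_ge0// ?expR_ge0// exprn_ge0// invr_ge0 ltW.
Qed.

(** The quadratic bound yields differentiability at the origin; it comes from the
    term of degree j + 2 of the exponential series at 1/s. *)
Lemma flat_le j s : flat j s <= j.+2`!%:R * s ^+ 2.
Proof.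
rewrite /flat; case: ifP => [s0|_]; last by rewrite mulr_ge0// sqr_ge0.
have i0 : 0 < s^-1 by rewrite invr_gt0.
have := expR_ge1Dxn j.+1 (ltW i0).
rewrite expRN => h.
have {}h : s^-1 ^+ j.+2 / j.+2`!%:R <= expR s^-1 by apply: le_trans h; rewrite lerDr.
rewrite ler_pdivrMr ?expR_gt0//.
apply: le_trans (_ : _ <= j.+2`!%:R * s ^+ 2 * (s^-1 ^+ j.+2 / j.+2`!%:R)) _; last first.
  by rewrite ler_wpM2l// mulr_ge0// sqr_ge0.
rewrite le_eqVlt; apply/orP; left; apply/eqP.
have : j.+2`!%:R != 0 :> R by rewrite pnatr_eq0 -lt0n fact_gt0.
rewrite [s^-1 ^+ j.+2]exprSr [s^-1 ^+ j.+1]exprSr.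
move: (j.+2`!%:R : R) (s^-1 ^+ j) => F u F0; field.
by rewrite F0 gt_eqF.
Qed.

Lemma is_derive_flat j s :
  is_derive s 1 (flat j) (flat j.+2 s - j%:R * flat j.+1 s).
Proof.
have [s0|s0|s0] := ltgtP s 0.
- rewrite /flat ltNge ltW//= mulr0 subr0.
  apply: (@near_eq_is_derive _ _ _ (cst 0)).
  near=> t; have t0 : t < 0 by near: t; apply: open_nbhs_nbhs; split => //; exact: open_lt.
  by rewrite /= ltNge ltW.
- pose g (t : R) : R := t^-1 ^+ j * expR (- t^-1).
  apply: (@near_eq_is_derive _ _ _ g).
    near=> t; have t0 : 0 < t by near: t; apply: open_nbhs_nbhs; split => //; exact: open_gt.
    by rewrite /flat /g t0.
  have sn0 : s != 0 by rewrite gt_eqF.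
  have dV : is_derive s 1 (fun t : R => t^-1) (- s ^- 2 *: 1).
    by apply: is_deriveV.
  have dX : is_derive s 1 (fun t : R => t^-1 ^+ j) (j%:R * s^-1 ^+ j.-1 *: (- s ^- 2 *: 1)).
    rewrite (_ : (fun t : R => _) = (fun t : R => t^-1) ^+ j); first exact: is_deriveX.
    by rewrite exprfctE.
  have dE : is_derive s 1 (fun t : R => expR (- t^-1)) (expR (- s^-1) * s ^- 2).
    have dN : is_derive s 1 (fun t : R => - t^-1) (s ^- 2).
      by apply: is_derive_eq; rewrite scaleNr opprK /GRing.scale/= mulr1.
    exact: is_derive1_comp.
  have := is_deriveM dX dE; rewrite /flat s0 => h.
  apply: is_derive_eq h _.
  rewrite /GRing.scale/=; case: j {dX g} => [|j].
    by rewrite !mul0r mulr0 addr0 subr0; field.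
  by rewrite /= !exprS; field.
- have f0 : flat j s = 0 by rewrite /flat s0 ltxx.
  rewrite s0 /flat ltxx mulr0 subr0 -/(flat j).
  have key : (fun h : R => h^-1 *: ((flat j \o shift (0 : R)) (h *: (1 : R)) - flat j 0))
      @ 0^' --> (0 : R).
    apply/cvgr0Pnorm_le => e e0; near=> h.
    have hn0 : h != 0 by near: h; exact: nbhs_dnbhs_neq.
    rewrite /= addr0 /GRing.scale/= mulr1 [X in _ - X]/flat ltxx subr0 normrM.
    rewrite normrV ?unitfE// ler_pdivrMl ?normr_gt0//.
    rewrite ger0_norm ?flat_ge0//; apply: le_trans (flat_le _ _) _.
    rewrite -[h ^+ 2]real_normK ?num_real// expr2 mulrCA ler_pM2l ?normr_gt0//.
    rewrite -ler_pdivlMl ?ltr0n ?fact_gt0//.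
    near: h; apply: dnbhs0_le; rewrite mulr_gt0// invr_gt0 ltr0n fact_gt0//.
  by apply: DeriveDef; [apply/cvg_ex; exists 0|exact: cvg_lim].
Unshelve. all: by end_near. Qed.

Lemma continuous_flat j : continuous (flat j).
Proof.
move=> s; apply: differentiable_continuous; apply/derivable1_diffP.
exact: (@ex_derive _ _ _ _ _ _ _ (is_derive_flat j s)).
Qed.

End flat_function.

Section derivative_line.
Variables (R : realType) (V : normedModType R).
Implicit Types f : V -> R.

Lemma derivative_lineE f (x v : V) :
  (fun h : R => h^-1 *: (((fun h : R => f (h *: v + x)) \o shift 0) (h *: 1) -
     (fun h : R => f (h *: v + x)) 0)) =
  (fun h : R => h^-1 *: ((f \o shift x) (h *: v) - f x)).
Proof.
by apply/funext => h /=; rewrite addr0 scale0r add0r /GRing.scale/= mulr1.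
Qed.

(** Directional derivatives are derivatives along a line, so that the chain rule
    of one real variable applies. *)
Lemma is_derive_line f (x v : V) d :
  is_derive x v f d <-> is_derive (0 : R) 1 (fun h : R => f (h *: v + x)) d.
Proof.
split=> -[a b]; apply: DeriveDef.
- by rewrite /derivable derivative_lineE.
- by rewrite /derive derivative_lineE.
- by move: a; rewrite /derivable derivative_lineE.
- by move: b; rewrite /derive derivative_lineE.
Qed.

End derivative_line.

Section smooth_functions.
Variables (R : realType) (n : nat).
Implicit Types (f g : 'rV[R]_n -> R) (x v : 'rV[R]_n).

Definition affine (a : 'rV[R]_n) (c : R) : 'rV[R]_n -> R :=
  fun x => c + \sum_i a ord0 i * x ord0 i.

Lemma affineD a c x y : affine a c (x + y) = affine a c x + affine a 0 y.
Proof.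
rewrite /affine add0r -addrA -big_split; congr (_ + _); apply: eq_bigr => i _.
by rewrite /= mxE mulrDr.
Qed.

Lemma affine0Z a h x : affine a 0 (h *: x) = h * affine a 0 x.
Proof.
rewrite /affine !add0r mulr_sumr; apply: eq_bigr => i _.
by rewrite mxE mulrCA.
Qed.

Lemma affine0_delta a i : affine a 0 'e_i = a ord0 i.
Proof.
rewrite /affine add0r (bigD1 i)//= big1 => [|j ji]; rewrite !mxE eqxx ?eqxx ?mulr1 ?addr0//=.
by rewrite (negbTE ji) mulr0.
Qed.

Lemma continuous_sum (I : Type) (r : seq I) (F : I -> 'rV[R]_n -> R) :
  (forall i, continuous (F i)) -> continuous (fun x => \sum_(i <- r) F i x).
Proof.
move=> cF; elim: r => [|i r IH].
  rewrite (_ : (fun _ => _) = cst 0); first exact: cst_continuous.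
  by apply/funext => x; rewrite big_nil.
rewrite (_ : (fun _ => _) = F i + (fun x => \sum_(i <- r) F i x)).
  by move=> x; apply: continuousD; [exact: cF|exact: IH].
by apply/funext => x; rewrite big_cons.
Qed.

Lemma continuous_affine a c : continuous (affine a c).
Proof.
move=> x; apply: (@continuousD _ _ _ (cst c)); first exact: cst_continuous.
apply: continuous_sum => i {}x; apply: (@continuousM _ _ (cst _)).
  exact: cst_continuous.
exact: coord_continuous.
Qed.

(** [smooth] constrains all iterated partial derivatives, so products and
    compositions are not handled by induction on the order.  It is enough that a
    class of continuous functions be stable under partial derivatives; this is
    the least such class needed here. *)
Inductive smooth_closure : ('rV[R]_n -> R) -> Prop :=
| SC_smooth f : smooth f -> smooth_closure f
| SC_cst c : smooth_closure (cst c)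
| SC_affine a c : smooth_closure (affine a c)
| SC_flat j a c : smooth_closure (flat j \o affine a c)
| SC_add f g : smooth_closure f -> smooth_closure g -> smooth_closure (f + g)
| SC_mul f g : smooth_closure f -> smooth_closure g -> smooth_closure (f * g).

Lemma smooth_partial f i : smooth f -> smooth (partial i f).
Proof. by move=> sf s; have := sf (rcons s i); rewrite foldr_rcons. Qed.

Lemma is_derive_affine a c x i : is_derive x 'e_i (affine a c) (a ord0 i).
Proof.
apply/is_derive_line.
have -> : (fun h : R => affine a c (h *: 'e_i + x)) =
   (fun h : R => h * a ord0 i) + cst (affine a c x).
  by apply/funext => h; rewrite addrC affineD affine0Z affine0_delta addrC.
apply: is_derive_eq; rewrite ?addr0.
by rewrite scaler0 add0r /GRing.scale/= mulr1.
Qed.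

Lemma is_derive_flat_affine j a c x i :
  is_derive x 'e_i (flat j \o affine a c)
    ((flat j.+2 (affine a c x) - j%:R * flat j.+1 (affine a c x)) * a ord0 i).
Proof.
apply/is_derive_line.
apply: (@is_derive1_comp _ (flat j) (fun h : R => affine a c (h *: 'e_i + x))).
  by rewrite scale0r add0r; exact: is_derive_flat.
exact: (is_derive_line (affine a c) x 'e_i _).1 (is_derive_affine a c x i).
Qed.

Lemma smooth_closure_derive f i : smooth_closure f ->
  exists2 g, smooth_closure g & forall x, is_derive x 'e_i f (g x).
Proof.
elim=> {f} [f sf|c|a c|j a c|f g cf [f' cf' df] cg [g' cg' dg]|
            f g cf [f' cf' df] cg [g' cg' dg]].
- exists (partial i f); first exact/SC_smooth/smooth_partial.
  move=> x; apply: DeriveDef => //; exact: (sf [::]).2.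
- exists (cst 0); first exact: SC_cst.
  by move=> x; exact: is_derive_cst.
- exists (cst (a ord0 i)); first exact: SC_cst.
  by move=> x; exact: is_derive_affine.
- exists ((flat j.+2 \o affine a c + cst (- j%:R) * (flat j.+1 \o affine a c)) * cst (a ord0 i)).
    apply: SC_mul; last exact: SC_cst.
    apply: SC_add; first exact: SC_flat.
    by apply: SC_mul; [exact: SC_cst|exact: SC_flat].
  move=> x; apply: is_derive_eq (is_derive_flat_affine j a c x i) _.
  by rewrite /= mulNr.
- exists (f' + g'); first exact: SC_add.
  by move=> x; exact: is_deriveD.
- exists (f * g' + g * f'); first by apply: SC_add; exact: SC_mul.
  by move=> x; exact: is_deriveM.
Qed.

Lemma smooth_closure_continuous f : smooth_closure f -> continuous f.
Proof.
elim=> {f} [f sf|c|a c|j a c|f g _ cf _ cg|f g _ cf _ cg].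
- exact: (sf [::]).1.
- exact: cst_continuous.
- exact: continuous_affine.
- by move=> x; apply: continuous_comp; [exact: continuous_affine|exact: continuous_flat].
- by move=> x; apply: continuousD; [exact: cf|exact: cg].
- by move=> x; apply: continuousM; [exact: cf|exact: cg].
Qed.

Lemma smooth_closure_smooth f : smooth_closure f -> smooth f.
Proof.
move=> cf s /=.
suff cs : smooth_closure (foldr (@partial R n) f s).
  split; first exact: smooth_closure_continuous.
  by move=> x i; have [g _ /(_ x)[]] := smooth_closure_derive i cs.
elim: s {cf} (cf) => //= i s IH /IH /(smooth_closure_derive i)[g cg dg].
rewrite (_ : partial i _ = g)//; apply/funext => x.
by rewrite /partial; case: (dg x).
Qed.

Lemma smooth_cst c : smooth (cst c : 'rV[R]_n -> R).
Proof. exact/smooth_closure_smooth/SC_cst. Qed.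

Lemma smooth_affine a c : smooth (affine a c).
Proof. exact/smooth_closure_smooth/SC_affine. Qed.

Lemma smooth_flat_affine j a c : smooth (flat j \o affine a c).
Proof. exact/smooth_closure_smooth/SC_flat. Qed.

Lemma smoothD f g : smooth f -> smooth g -> smooth (f + g).
Proof. by move=> sf sg; apply/smooth_closure_smooth/SC_add; exact: SC_smooth. Qed.

Lemma smoothM f g : smooth f -> smooth g -> smooth (f * g).
Proof. by move=> sf sg; apply/smooth_closure_smooth/SC_mul; exact: SC_smooth. Qed.

Lemma smooth_sum (I : Type) (r : seq I) (P : pred I) (F : I -> 'rV[R]_n -> R) :
  (forall i, P i -> smooth (F i)) -> smooth (fun x => \sum_(i <- r | P i) F i x).
Proof.
move=> sF; elim: r => [|i r IH].
  rewrite (_ : (fun _ => _) = cst 0); first exact: smooth_cst.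
  by apply/funext => x; rewrite big_nil.
case Pi: (P i); last first.
  by rewrite (_ : (fun _ => _) = (fun x => \sum_(i <- r | P i) F i x))//;
    apply/funext => x; rewrite big_cons Pi.
rewrite (_ : (fun _ => _) = F i + (fun x => \sum_(i <- r | P i) F i x)).
  by apply: smoothD => //; exact: sF.
by apply/funext => x; rewrite big_cons Pi.
Qed.

Lemma smooth_prod (I : Type) (r : seq I) (F : I -> 'rV[R]_n -> R) :
  (forall i, smooth (F i)) -> smooth (fun x => \prod_(i <- r) F i x).
Proof.
move=> sF; elim: r => [|i r IH].
  rewrite (_ : (fun _ => _) = cst 1); first exact: smooth_cst.
  by apply/funext => x; rewrite big_nil.
rewrite (_ : (fun _ => _) = F i * (fun x => \prod_(i <- r) F i x)).
  exact: smoothM.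
by apply/funext => x; rewrite big_cons.
Qed.

Lemma smooth_continuous f : smooth f -> continuous f.
Proof. by move=> /(_ [::])[]. Qed.

Lemma smooth_is_derive f x i : smooth f -> is_derive x 'e_i f (partial i f x).
Proof. by move=> /(_ [::])[_ df]; apply: DeriveDef => //; exact: df. Qed.

Lemma partialM f g x i : smooth f -> smooth g ->
  partial i (f * g) x = f x * partial i g x + g x * partial i f x.
Proof.
move=> sf sg.
by have [_ h] := is_deriveM (smooth_is_derive x i sf) (smooth_is_derive x i sg); exact: h.
Qed.

Lemma partial_affine a c x i : partial i (affine a c) x = a ord0 i.
Proof. by have [_ h] := is_derive_affine a c x i; exact: h. Qed.

Lemma partial_near f g x i : (\near x, f x = g x) -> partial i f x = partial i g x.
Proof. by move=> fg; rewrite /partial (near_eq_derive _ fg). Qed.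

End smooth_functions.

(** * Integration by parts *)

Section integration_by_parts.
Variables (R : realType) (n : nat).
Implicit Types (f g : 'rV[R]_n -> R) (x v : 'rV[R]_n).

Lemma continuous_bounded_box f (M : R) : continuous f ->
  exists C, forall x, (forall j, `|x ord0 j| <= M) -> `|f x| <= C.
Proof.
move=> cf.
pose K := [set v : 'rV[R]_n | forall i, v ord0 i \in `[(- M), M]].
have cK : compact K.
  by apply: (@rV_compact _  _ (fun=> `[(- M), M]%classic)) => _; exact: segment_compact.
have : bounded_set (f @` K).
  by apply: compact_bounded; apply: continuous_compact => //; exact: continuous_subspaceT.
move=> [C [_ /(_ (C + 1))]]; rewrite ltrDl => /(_ ltr01) h.
exists (C + 1) => x xM; apply: h; exists x => //= i.
by rewrite in_itv/= -ler_norml.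
Qed.

(** At a point with a coordinate of absolute value at least M + 1 the function
    vanishes on a whole neighborhood, which the box of size M alone would not
    guarantee. *)
Lemma partial_support_box f i x (M : R) : (forall x, f x != 0 -> forall j, `|x ord0 j| < M) ->
  partial i f x != 0 -> forall j, `|x ord0 j| < M + 1.
Proof.
move=> fM + j; apply: contraNT; rewrite -leNgt => Mx; apply/eqP.
rewrite (_ : 0 = partial i (cst 0) x); last by rewrite /partial derive_cst.
apply: partial_near; near=> y.
apply/eqP; apply: contraT => /fM/(_ j); rewrite ltNge => /negP; case; apply: ltW.
have : `|x ord0 j - y ord0 j| < 1.
  near: y; have := @coord_continuous R 1 n ord0 j x.
  by move=> /cvgrPdist_lt; apply.
have := ler_normD (x ord0 j - y ord0 j) (y ord0 j); rewrite subrK; lra.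
Unshelve. all: by end_near. Qed.

Lemma rV_tset t i (y : R) :
  rV_of_tuple (tset t i y) = (y - tnth t i) *: 'e_i + rV_of_tuple t :> 'rV[R]_n.
Proof.
apply/rowP => j; rewrite !mxE tnth_tset eqxx /= eq_sym; case: eqP => [->|_].
  by rewrite mulr1 subrK.
by rewrite mulr0 add0r.
Qed.

(** The fundamental theorem of calculus on a segment whose ends lie outside the
    support. *)
Lemma integral_line_partial f i (M : R) t : smooth f ->
  (forall x, f x != 0 -> forall j, `|x ord0 j| < M) ->
  (\int[lebesgue_measure]_y (partial i f (rV_of_tuple (tset t i y)))%:E = 0)%E.
Proof.
move=> sf fM; pose N := `|M| + 1.
pose L (y : R) : 'rV[R]_n := (y - tnth t i) *: 'e_i + rV_of_tuple t.
have Li y : L y ord0 i = y by rewrite -[L y]rV_tset mxE tnth_tset eqxx.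
have cL : continuous L.
  move=> y; apply: cvgD; last exact: cvg_cst.
  apply: cvgZr_tmp; apply: cvgB; [exact: cvg_id|exact: cvg_cst].
have MN : M < N by rewrite /N; have := ler_norm M; lra.
have dF (y : R) : is_derive y (1 : R) (f \o L) (partial i f (L y)).
  apply/is_derive_line.
  rewrite (_ : (fun h : R => _) = (fun h : R => f (h *: 'e_i + L y))).
    exact: (is_derive_line f (L y) 'e_i _).1 (smooth_is_derive _ _ sf).
  apply/funext => h /=; congr f; rewrite /L [h *: 1]mulr1 [RHS]addrA -scalerDl.
  by rewrite addrA.
have N0 : 0 < N by rewrite ltr_wpDl.
have F0 (y : R) : N <= `|y| -> (f \o L) y = 0.
  move=> Ny; apply/eqP; apply: contraT => /fM/(_ i); rewrite Li => h.
  by have := lt_trans (lt_le_trans MN Ny) h; rewrite ltxx.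
have dF0 (y : R) : N < `|y| -> partial i f (L y) = 0.
  move=> Ny; rewrite /N in Ny; apply/eqP; apply: contraT.
  move=> /(partial_support_box fM)/(_ i); rewrite Li.
  have := ler_norm M; lra.
have cdF : continuous (fun y => partial i f (L y)).
  move=> y; apply: continuous_comp; first exact: cL.
  exact: smooth_continuous (smooth_partial i sf) _.
have cF : continuous (f \o L).
  by move=> y; apply: continuous_comp; [exact: cL|exact: smooth_continuous].
transitivity (\int[lebesgue_measure]_(y in `[(- N)%R, N]) (partial i f (L y))%:E)%E.
  rewrite [RHS]integral_mkcond; apply: eq_integral => y _; rewrite rV_tset -/(L y).
  rewrite patchE; case: ifPn => //.
  by rewrite notin_setE/= in_itv/= -ler_norml => /negP; rewrite -ltNge => /dF0 ->.
rewrite (@continuous_FTC2 _ _ (f \o L)).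
- by rewrite !F0 ?normrN ?(gtr0_norm N0)// subee.
- by rewrite -subr_gt0 opprK addr_gt0.
- exact: continuous_subspaceT.
- split.
  + by move=> y _; case: (dF y).
  + exact/cvg_at_right_filter/cF.
  + exact/cvg_at_left_filter/cF.
- by move=> y _; rewrite derive1E; case: (dF y).
Qed.

Lemma integral_partial f i (M : R) : smooth f ->
  (forall x, f x != 0 -> forall j, `|x ord0 j| < M) ->
  (lebesgue_tuple R n).-integrable setT
     (fun t => (partial i f (rV_of_tuple t))%:E) /\
  (\int[lebesgue_tuple R n]_t (partial i f (rV_of_tuple t))%:E = 0)%E.
Proof.
move=> sf fM.
have cf := smooth_continuous (smooth_partial i sf).
have [C fC] := continuous_bounded_box (M + 1) cf.
have fC' (t : n.-tuple (measurableTypeR R)) :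
    `|partial i f (rV_of_tuple t)| <= Num.max C 0.
  have [->|/(partial_support_box fM) h] := eqVneq (partial i f (rV_of_tuple t)) 0.
    by rewrite normr0 le_max lexx orbT.
  by rewrite le_max fC// => j; exact/ltW/h.
have mf := measurable_fun_continuous_rV cf.
have suppf (t : n.-tuple (measurableTypeR R)) : partial i f (rV_of_tuple t) != 0 ->
    forall j, `|tnth t j| < M + 1.
  by move=> /(partial_support_box fM) h j; have := h j; rewrite mxE.
split; first exact: (integrable_bounded_box mf fC' suppf).
apply: (integral0_lines (i := i) mf fC' suppf) => t.
exact: integral_line_partial sf fM.
Qed.

End integration_by_parts.

(** * Coordinate formulas for forms *)

Section partial_rules.
Variables (R : realType) (n : nat).
Implicit Types (f g : 'rV[R]_n -> R).

Lemma partial_cst (c : R) x i : partial i (cst c : 'rV[R]_n -> R) x = 0.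
Proof. by rewrite /partial derive_cst. Qed.

Lemma partialD f g x i : smooth f -> smooth g ->
  partial i (fun y => f y + g y) x = partial i f x + partial i g x.
Proof.
move=> sf sg.
by have [_ h] := is_deriveD (smooth_is_derive x i sf) (smooth_is_derive x i sg); exact: h.
Qed.

Lemma partialZ (c : R) f x i : smooth f ->
  partial i (fun y => c * f y) x = c * partial i f x.
Proof.
move=> sf; have := partialM x i (smooth_cst c) sf.
by rewrite partial_cst mulr0 addr0 => h; exact: h.
Qed.

Lemma smoothZ (c : R) f : smooth f -> smooth (fun y => c * f y).
Proof. by move=> sf; exact: (smoothM (smooth_cst c) sf). Qed.

End partial_rules.

Section signs.
Variable n : nat.
Implicit Types (A B : {set 'I_n}) (i : 'I_n).

Lemma beforeE i A : before i A = (\sum_(j in A) (j < i : nat))%N.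
Proof.
rewrite /before -sum1_card [RHS]big_mkcond [LHS]big_mkcond.
by apply: eq_bigr => j _; rewrite inE; case: (j \in A) => //=; case: (j < i)%N.
Qed.

Lemma before_setU1 i A : before i (i |: A) = before i A.
Proof.
apply: eq_card => j; rewrite !inE; case: eqP => [->|//].
by rewrite ltnn !andbF.
Qed.

Lemma before_setD1 i A : before i (A :\ i) = before i A.
Proof.
apply: eq_card => j; rewrite !inE; case: eqP => [->|//].
by rewrite ltnn !andbF.
Qed.

Lemma inversionsE A :
  inversions A = (\sum_(p in A) \sum_(q in ~: A) (q < p : nat))%N.
Proof.
rewrite /inversions -sum1_card pair_big [RHS]big_mkcond [LHS]big_mkcond.
apply: eq_bigr => -[p q] _; rewrite !inE /=.
by case: (p \in A) => //=; case: (q \notin A) => //=; case: (q < p)%N.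
Qed.

(** Each pair of an element of A and an element of its complement is an inversion
    for exactly one of the two sets. *)
Lemma inversions_setC A : (inversions A + inversions (~: A) = #|A| * (n - #|A|))%N.
Proof.
rewrite !inversionsE finset.setCK [X in (_ + X)%N]exchange_big -big_split /=.
rewrite (eq_bigr (fun=> n - #|A|)%N) ?sum_nat_const// => p pA.
rewrite -big_split/= (eq_bigr (fun=> 1%N)) ?sum1_card.
  by rewrite finset.cardsCs finset.setCK card_ord.
move=> q; rewrite inE => qA.
have : p != q by apply: contraNneq qA => <-.
by rewrite -val_eqE/= neq_ltn; case: ltngtP.
Qed.

(** Moving i from the complement into A creates the inversions of i with the
    smaller elements outside A and destroys those with the larger elements of
    A, of which there are |A| - [before i A]. *)
Lemma inversions_setU1 i A : i \notin A ->
  (inversions (i |: A) + #|A| = inversions A + before i A + before i (~: A))%N.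
Proof.
move=> iA; rewrite !inversionsE big_setU1//=.
have CE : ~: A = i |: ~: (i |: A).
  by apply/finset.setP => j; rewrite !inE negb_or; case: eqP => [->|].
have iC : i \notin ~: (i |: A) by rewrite !inE eqxx.
rewrite [X in _ = (X + _ + _)%N](eq_bigr (fun p : 'I_n =>
   (i < p) + \sum_(q in ~: (i |: A)) (q < p))%N); last first.
  by move=> p pA; rewrite CE big_setU1.
rewrite big_split/= [before i (~: A)]beforeE CE big_setU1//= ltnn add0n.
suff : (\sum_(p in A) (i < p) + before i A = #|A|)%N.
  by move=> <-; rewrite [LHS](AC (2*2) (3*2*4*1)).
rewrite beforeE -big_split -sum1_card; apply: eq_bigr => p pA /=.
have : p != i by apply: contraNneq iA => <-.
by rewrite -val_eqE/= neq_ltn; case: ltngtP.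
Qed.

End signs.

Section form_algebra.
Variables (R : realType) (n : nat).
Implicit Types (omega eta p phi : dform R n) (A B C : {set 'I_n}).
Implicit Types (c x : 'rV[R]_n) (a : {set 'I_n} -> R) (i j : 'I_n) (k : nat).

Lemma sum_dx (F : {set 'I_n} -> R) (h : {set 'I_n} -> {set 'I_n}) B :
  \sum_A F A * dx R (h A) B = \sum_(A | h A == B) F A.
Proof.
rewrite [RHS]big_mkcond; apply: eq_bigr => A _.
by rewrite /dx eq_sym; case: eqP => _; rewrite ?mulr1 ?mulr0.
Qed.

Lemma extdE omega x B : extd omega x B =
  \sum_(i in B) (-1) ^+ before i B * partial i (omega ^~ (B :\ i)) x.
Proof.
rewrite /extd (exchange_big_dep predT)//= [RHS]big_mkcond; apply: eq_bigr => i _.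
case: ifPn => iB; last first.
  rewrite big1// => A iA; rewrite /dx (_ : (B == _) = false) ?mulr0//.
  by apply: contraNF iB => /eqP ->; rewrite finset.setU11.
rewrite (bigD1 (B :\ i)) ?finset.setD11//= big1 ?addr0 => [|A /andP[iA AB]].
  by rewrite /dx finset.setD1K// eqxx mulr1 before_setD1 mulrC.
rewrite /dx (_ : (B == _) = false) ?mulr0//.
by apply: contraNF AB => /eqP ->; rewrite finset.setU1K.
Qed.

Lemma hodgeE omega x B : hodge omega x B = (-1) ^+ inversions (~: B) * omega x (~: B).
Proof.
rewrite /hodge sum_dx (big_pred1 (~: B)) => [|A]; first by rewrite mulrC.
by rewrite /= -(inj_eq (@finset.setC_inj _)) finset.setCK.
Qed.

Lemma koszulE c omega x B : koszul c omega x B =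
  \sum_(i | i \notin B) (-1) ^+ before i B * omega x (i |: B) * (x - c) ord0 i.
Proof.
rewrite /koszul.
under eq_bigr do rewrite mulr_sumr.
rewrite (exchange_big_dep predT)//= [RHS]big_mkcond; apply: eq_bigr => i _.
case: ifPn => iB; last first.
  rewrite negbK in iB; rewrite big1// => A iA; rewrite /dx (_ : (B == _) = false) ?mulr0//.
  by apply: contraTF iB => /eqP ->; rewrite finset.setD11.
rewrite (bigD1 (i |: B)) ?finset.setU11//= big1 ?addr0 => [|A /andP[iA AB]].
  by rewrite /dx finset.setU1K// eqxx mulr1 before_setU1; ring.
rewrite /dx (_ : (B == _) = false) ?mulr0//.
by apply: contraNF AB => /eqP ->; rewrite finset.setD1K.
Qed.

Lemma signr_sq m : (-1) ^+ m * (-1) ^+ m = 1 :> R.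
Proof. by rewrite -expr2 sqrr_sign. Qed.

Lemma hodgeK omega x A :
  hodge (hodge omega) x A = (-1) ^+ (#|A| * (n - #|A|)) * omega x A.
Proof.
by rewrite !hodgeE finset.setCK mulrA -exprD addnC inversions_setC.
Qed.

Lemma kform_hodge k omega : (k <= n)%N -> kform k omega -> kform (n - k) (hodge omega).
Proof.
move=> kn ko x A Ak; rewrite hodgeE ko ?mulr0//.
by apply: contraNneq Ak => <-; rewrite finset.cardsCs card_ord.
Qed.

Lemma card_setU1N i A : i \notin A -> #|i |: A| = #|A|.+1.
Proof. by move=> iA; rewrite finset.cardsU1 iA. Qed.

Lemma kform_koszul k c omega : kform k.+1 omega -> kform k (koszul c omega).
Proof.
move=> ko x A Ak; rewrite koszulE big1// => i iA.
by rewrite ko ?mulr0 ?mul0r// card_setU1N// eqSS.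
Qed.

Definition smooth_form omega := forall A, smooth (omega ^~ A).

Lemma smooth_coord c i : smooth (fun x => (x - c) ord0 i).
Proof.
rewrite (_ : (fun _ => _) = affine 'e_i (- c ord0 i)); first exact: smooth_affine.
apply/funext => x; rewrite /affine (bigD1 i)//= !mxE !eqxx mul1r big1 ?addr0 => [|j ji].
  by rewrite addrC.
by rewrite mxE eqxx/= (negbTE ji) mul0r.
Qed.

Lemma partial_coord c i j x : partial i (fun x => (x - c) ord0 j) x = (i == j)%:R.
Proof.
rewrite (_ : (fun _ => _) = affine 'e_j (- c ord0 j)).
  by rewrite partial_affine mxE eqxx/=.
apply/funext => y; rewrite /affine (bigD1 j)//= !mxE !eqxx mul1r big1 ?addr0 => [|l ji].
  by rewrite addrC.
by rewrite mxE eqxx/= (negbTE ji) mul0r.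
Qed.

Lemma partial_sum (I : Type) (r : seq I) (P : pred I) (F : I -> 'rV[R]_n -> R) x i :
  (forall l, P l -> smooth (F l)) ->
  partial i (fun y => \sum_(l <- r | P l) F l y) x = \sum_(l <- r | P l) partial i (F l) x.
Proof.
move=> sF; elim: r => [|l r IH].
  rewrite big_nil (_ : (fun _ => _) = cst 0) ?partial_cst//.
  by apply/funext => y; rewrite big_nil.
rewrite big_cons; case: ifPn => Pl.
  rewrite -IH -partialD; [|exact: sF|exact: smooth_sum].
  by congr (partial i _ x); apply/funext => y; rewrite big_cons Pl.
by rewrite -IH; congr (partial i _ x); apply/funext => y; rewrite big_cons (negbTE Pl).
Qed.

Lemma smooth_koszul c a : smooth_form (koszul c (fun=> a)).
Proof.
move=> B; rewrite (_ : _ ^~ B = fun x =>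
    \sum_(i | i \notin B) ((-1) ^+ before i B * a (i |: B)) * (x - c) ord0 i).
  by apply: smooth_sum => i _; apply: smoothZ; exact: smooth_coord.
by apply/funext => x; rewrite koszulE.
Qed.

Lemma partial_koszul c a x B i :
  partial i ((koszul c (fun=> a)) ^~ B) x =
  if i \in B then 0 else (-1) ^+ before i B * a (i |: B).
Proof.
rewrite (_ : _ ^~ B = fun x =>
    \sum_(i | i \notin B) ((-1) ^+ before i B * a (i |: B)) * (x - c) ord0 i); last first.
  by apply/funext => y; rewrite koszulE.
rewrite partial_sum => [|j _]; last by apply: smoothZ; exact: smooth_coord.
rewrite (eq_bigr (fun j => ((-1) ^+ before j B * a (j |: B)) * (i == j)%:R)); last first.
  by move=> j _; rewrite partialZ ?partial_coord//; exact: smooth_coord.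
case: ifPn => iB.
  rewrite big1// => j jB; rewrite (_ : (i == j) = false) ?mulr0//.
  by apply: contraNF jB => /eqP <-.
rewrite (bigD1 i)//= eqxx mulr1 big1 ?addr0// => j /andP[_ ji].
by rewrite eq_sym (negbTE ji) mulr0.
Qed.

(** The homotopy formula for constant forms: each of the |B| indices i of B
    contributes a_B, and the two signs of i cancel. *)
Lemma extd_koszul c a x B : extd (koszul c (fun=> a)) x B = #|B|%:R * a B.
Proof.
rewrite extdE (eq_bigr (fun=> a B)) => [|i iB].
  by rewrite sumr_const mulr_natl.
by rewrite partial_koszul finset.setD11 before_setD1 mulrA signr_sq mul1r finset.setD1K.
Qed.

(** The degree-dependent sign in the definition of the codifferential cancels
    against the signs of the two Hodge stars up to one minus, as befits the
    adjoint of d. *)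
Lemma codiffE k phi x A : smooth_form phi -> kform k.+1 phi ->
  codiff k.+1 phi x A =
  - \sum_(i | i \notin A) (-1) ^+ before i A * partial i (phi ^~ (i |: A)) x.
Proof.
move=> sp kp; have [Ak|Ak] := eqVneq #|A| k; last first.
  rewrite /codiff hodgeE extdE big1 ?mulr0 => [|i]; last first.
    rewrite inE => iA; rewrite (_ : _ ^~ _ = cst 0) ?partial_cst ?mulr0//.
    apply/funext => y; rewrite hodgeE finset.setCD finset.setCK finset.setUC kp ?mulr0//.
    by rewrite card_setU1N// eqSS.
  rewrite big1 ?oppr0// => i iA; rewrite (_ : _ ^~ _ = cst 0) ?partial_cst ?mulr0//.
  by apply/funext => y; rewrite kp// card_setU1N// eqSS.
rewrite /codiff hodgeE extdE !mulr_sumr -sumrN.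
apply: eq_big => [i|i]; rewrite inE// => iA.
have -> : (hodge phi) ^~ (~: A :\ i) =
    (fun y => (-1) ^+ inversions (i |: A) * phi y (i |: A)).
  by apply/funext => y; rewrite hodgeE finset.setCD finset.setCK finset.setUC.
rewrite partialZ// !mulrA -!exprD -mulNr; congr (_ * _).
rewrite -[RHS]mulN1r -exprS -signr_odd -[RHS]signr_odd; congr (_ ^+ nat_of_bool _).
have h1 := inversions_setU1 iA; have h2 := inversions_setC A.
rewrite Ak in h1 h2.
have kn : (k <= n)%N by rewrite -Ak -[X in (_ <= X)%N]card_ord max_card.
(* The signs agree because of these two counts modulo 2. *)
move: (congr1 odd h1) (congr1 odd h2); rewrite !oddD !oddM !oddS oddB//.
rewrite -/(before i (~: A)).
by case: (odd n); case: (odd k); case: (odd (inversions A)); case: (odd (inversions (~: A)));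
  case: (odd (inversions (i |: A))); case: (odd (before i A)); case: (odd (before i (~: A))).
Qed.

(** The difference is a divergence: this is the pointwise form of the adjointness
    of d and delta. *)
Lemma dotf_extd_codiff k p phi x : smooth_form p -> smooth_form phi -> kform k.+1 phi ->
  dotf (extd p) phi x - dotf p (codiff k.+1 phi) x =
  \sum_(A : {set 'I_n}) \sum_(i | i \notin A)
     (-1) ^+ before i A * partial i (fun y => p y A * phi y (i |: A)) x.
Proof.
move=> sp sphi kp.
have -> : dotf (extd p) phi x = \sum_(A : {set 'I_n}) \sum_(i | i \notin A)
    (-1) ^+ before i A * (partial i (p ^~ A) x * phi x (i |: A)).
  rewrite /dotf /extd; under eq_bigr do rewrite mulr_suml.
  rewrite exchange_big/=; apply: eq_bigr => A _.
  under eq_bigr do rewrite mulr_suml.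
  rewrite exchange_big/=; apply: eq_bigr => i iA.
  rewrite (bigD1 (i |: A))//= big1 ?addr0 => [|B BA]; rewrite /dx.
    by rewrite eqxx mulr1 mulrAC mulrC.
  by rewrite (negbTE BA) mulr0 mul0r.
rewrite /dotf -sumrB; apply: eq_bigr => A _.
rewrite codiffE// mulrN opprK mulr_sumr -big_split; apply: eq_bigr => i iA /=.
have := partialM x i (sp A) (sphi (i |: A)) => ->.
  by ring.
Qed.

End form_algebra.

(** * Whitney forms and star Whitney forms *)

Section whitney_forms.
Variables (R : realType) (n : nat).
Implicit Types (omega eta p phi : dform R n) (A B C : {set 'I_n}).
Implicit Types (c x : 'rV[R]_n) (a b q : {set 'I_n} -> R) (i j : 'I_n) (k : nat).

Definition homogeneous k a := forall A, #|A| != k -> a A = 0.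

Lemma kform_cst k a : homogeneous k a <-> kform k ((fun=> a) : dform R n).
Proof. by split=> [ha x A|ka A Ak]; [exact: ha|exact: (ka 0)]. Qed.

Definition whitney c a b : dform R n := fun x A => a A + koszul c (fun=> b) x A.

(** Changing the base point of the Koszul operator adds a constant form. *)
Lemma koszul_recenter c c' a x B :
  koszul c (fun=> a) x B = koszul c (fun=> a) c' B + koszul c' (fun=> a) x B.
Proof.
rewrite !koszulE -big_split; apply: eq_bigr => i iB /=.
by rewrite -mulrDr !mxE; congr (_ * _); ring.
Qed.

(** Whitney forms do not depend on the base point, so that the barycenter of the
    cell at hand may be used instead of the origin. *)
Lemma whitneyP k c p : P1minus k p <->
  exists a b, [/\ homogeneous k a, homogeneous k.+1 b & p = whitney c a b].
Proof.
split=> [[w [ka [a wE]] [z [w' [kb [b w'E]] zE] pE]]|[a [b [ha hb ->]]]].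
- subst w w' z p.
  exists (fun A => a A + koszul 0 (fun=> b) c A), b.
  move/kform_cst : kb => hb; move/kform_cst : ka => ha; split => //.
    by move=> A Ak; rewrite ha// add0r; apply: (kform_koszul _ _ _ Ak); exact: (kform_cst _ _).1 hb.
  apply/funext => x; apply/funext => A; rewrite /whitney.
  by rewrite -addrA -(koszul_recenter 0 c).
- exists (fun=> fun A => a A + koszul c (fun=> b) 0 A).
    split; last by eexists.
    move=> x A Ak; rewrite ha// add0r; apply: (kform_koszul _ _ _ Ak); exact: (kform_cst _ _).1 hb.
  exists (koszul 0 (fun=> b)).
    by exists (fun=> b) => //; split; [exact/kform_cst|exists b].
  apply/funext => x; apply/funext => A; rewrite /whitney.
  by rewrite (koszul_recenter c 0) addrA.
Qed.

Lemma whitney_cst c a : whitney c a (fun=> 0) = fun=> a.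
Proof.
apply/funext => x; apply/funext => A; rewrite /whitney koszulE big1 ?addr0// => i _.
by rewrite mulr0 mul0r.
Qed.

Lemma smooth_whitney c a b : smooth_form (whitney c a b).
Proof. by move=> A; apply: (smoothD (smooth_cst (a A))); exact: smooth_koszul. Qed.

Lemma kform_whitney k c a b : homogeneous k a -> homogeneous k.+1 b ->
  kform k (whitney c a b).
Proof.
move=> ha hb x A Ak; rewrite /whitney ha// add0r.
by apply: (kform_koszul _ _ _ Ak); exact: (kform_cst _ _).1 hb.
Qed.

Lemma partial_whitney c a b x A i :
  partial i (whitney c a b ^~ A) x = partial i (koszul c (fun=> b) ^~ A) x.
Proof.
rewrite /whitney partialD; [|exact: smooth_cst|exact: smooth_koszul].
by rewrite partial_cst add0r.
Qed.

Lemma extd_whitney c a b x B : extd (whitney c a b) x B = #|B|%:R * b B.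
Proof.
rewrite -(extd_koszul c b x) !extdE; apply: eq_bigr => i iB.
by rewrite partial_whitney.
Qed.

(** Up to sign delta star = star d, so the codifferential of the star of a Whitney
    form is read off from [extd_whitney]. *)
Lemma hodge_whitney_codiff k c a b x A : (k < n)%N ->
  homogeneous (n - k.+1) a -> homogeneous (n - k) b ->
  codiff k.+1 (hodge (whitney c a b)) x A =
  (-1) ^+ (n * k.+2 + 1 + k.+1 * (n - k.+1)) * (n - k)%:R *
    hodge (fun=> b) x A.
Proof.
move=> kn ha hb; rewrite -subnSK// in hb.
have kw := kform_whitney c ha hb; set w := whitney c a b in kw *.
have sw : smooth_form w by exact: smooth_whitney.
have HH : hodge (hodge w) = fun y B => (-1) ^+ (k.+1 * (n - k.+1)) * w y B.
  apply/funext => y; apply/funext => B; rewrite hodgeK.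
  have [Bk|Bk] := eqVneq #|B| (n - k.+1)%N; last by rewrite kw// !mulr0.
  by rewrite Bk subKn// mulnC.
rewrite /codiff HH hodgeE extdE.
rewrite (eq_bigr (fun i => (-1) ^+ (k.+1 * (n - k.+1)) * ((-1) ^+ before i (~: A) *
   partial i (w ^~ (~: A :\ i)) x))) => [|i _]; last by rewrite partialZ// mulrCA.
rewrite -mulr_sumr -extdE extd_whitney hodgeE [(-1) ^+ (_ + 1 + _)]exprD.
have [Ak|Ak] := eqVneq #|~: A| (n - k)%N; last first.
  by rewrite hb ?mulr0// subnSK.
by rewrite Ak !mulrA [LHS](ACl (1*3*4*2*5)).
Qed.

Lemma homogeneous_hodge k q : (k <= n)%N -> homogeneous (n - k) q ->
  homogeneous k (fun A => (-1) ^+ inversions A * q (~: A)).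
Proof.
move=> kn hq A Ak; rewrite hq ?mulr0//; apply: contraNneq Ak => h.
have := cardsC A; rewrite card_ord; lia.
Qed.

(** A star Whitney form is determined by its value q at c and its codifferential
    e, and both may be prescribed; q is also its mean when c is the barycenter.
    The factor n - k of [hodge_whitney_codiff] is invertible for k < n. *)
Lemma P1starminus_exists k c q e : (k < n)%N ->
  homogeneous k.+1 q -> homogeneous k e ->
  exists eta, [/\ P1starminus k.+1 eta, smooth_form eta, kform k.+1 eta,
    forall x A, codiff k.+1 eta x A = e A &
    exists l : {set 'I_n} -> 'I_n -> R,
      forall x A, eta x A = q A + \sum_i l A i * (x - c) ord0 i].
Proof.
move=> kn hq he.
(* [s], [a] and [b] invert the Hodge star and the factor s (n - k) of
   [hodge_whitney_codiff]. *)
pose s : R := (-1) ^+ (n * k.+2 + 1 + k.+1 * (n - k.+1)).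
pose a A := (-1) ^+ inversions A * q (~: A).
pose b A := s * (n - k)%:R^-1 * ((-1) ^+ inversions A * e (~: A)).
have ha : homogeneous (n - k.+1) a.
  by apply: homogeneous_hodge; [exact: leq_subr|rewrite subKn].
have hb : homogeneous (n - k) b.
  move=> A Ak; rewrite /b (_ : _ * e _ = 0) ?mulr0//.
  by apply: homogeneous_hodge Ak; [exact: leq_subr|rewrite subKn// ltnW].
have kw : kform (n - k.+1) (whitney c a b).
  by apply: kform_whitney => //; rewrite subnSK.
exists (hodge (whitney c a b)); split.
- exists (whitney c a b) => //; apply/(whitneyP _ c); exists a, b; split => //.
  by rewrite subnSK.
- move=> A; rewrite (_ : _ ^~ A = fun x => (-1) ^+ inversions (~: A) * whitney c a b x (~: A)).
    exact/smoothZ/smooth_whitney.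
  by apply/funext => x; rewrite hodgeE.
- by rewrite -[X in kform X](@subKn k.+1 n)//; apply: kform_hodge kw; exact: leq_subr.
- move=> x A; rewrite hodge_whitney_codiff// hodgeE /b finset.setCK -/s.
  have n0 : (n - k)%:R != 0 :> R by rewrite pnatr_eq0 subn_eq0 -ltnNge.
  have ss : s * s = 1 by exact: signr_sq.
  have ii : (-1) ^+ inversions (~: A) * (-1) ^+ inversions (~: A) = 1 :> R by exact: signr_sq.
  have key (u v m z : R) : u * u = 1 -> v * v = 1 -> m != 0 ->
      u * m * (v * (u / m * (v * z))) = z.
    move=> uu vv m0.
    transitivity ((u * u) * (v * v) * z); first by field.
    by rewrite uu vv !mul1r.
  exact: key.
- exists (fun A i => if i \in ~: A then 0 else
     (-1) ^+ inversions (~: A) * ((-1) ^+ before i (~: A) * b (i |: ~: A))).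
  move=> x A; rewrite hodgeE /whitney /a finset.setCK mulrDr mulrA signr_sq mul1r.
  congr (_ + _); rewrite koszulE mulr_sumr big_mkcond; apply: eq_bigr => i _.
  by case: ifPn; rewrite ?negbK => iA; rewrite ?iA ?mul0r// (negbTE iA) !mulrA.
Qed.

Lemma partial_eq0_open (U : set 'rV[R]_n) (f : 'rV[R]_n -> R) x i :
  open U -> U x -> (forall y, U y -> f y = 0) -> partial i f x = 0.
Proof.
move=> oU Ux fU; rewrite -(partial_cst 0 x i); apply: partial_near.
by near=> y; apply: fU; near: y; exact: open_nbhs_nbhs.
Unshelve. all: by end_near. Qed.

End whitney_forms.

(** * Closed and coclosed forms of the enriched space *)

Section enriched_space.
Variables (R : realType) (n : nat) (T : {fset 'rV[R]_n}).
Implicit Types (p : dform R n) (A B C I : {set 'I_n}) (x : 'rV[R]_n).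
Implicit Types (a b s : {set 'I_n} -> R) (i j : 'I_n) (k : nat).
Let c := barycenter T.

(** [bubble T I A] is this function times the constant form dx^A. *)
Definition square_deviation I x : R :=
  \sum_(i in I) ((x - c) ord0 i ^+ 2 - moment T i).

Lemma smooth_square_deviation I : smooth (square_deviation I).
Proof.
apply: smooth_sum => j _.
apply: (smoothD (g := cst (- moment T j))); last exact: smooth_cst.
exact: (smoothM (smooth_coord c j) (smooth_coord c j)).
Qed.

Lemma partial_square_deviation I i x : partial i (square_deviation I) x =
  if i \in I then 2 * (x - c) ord0 i else 0.
Proof.
have sq j : smooth (fun x => (x - c) ord0 j ^+ 2).
  exact: (smoothM (smooth_coord c j) (smooth_coord c j)).
have dm j : partial i (fun x => (x - c) ord0 j ^+ 2 - moment T j) x =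
    (i == j)%:R * (2 * (x - c) ord0 j).
  rewrite (partialD (g := cst (- moment T j)) x i (sq j)); last exact: smooth_cst.
  rewrite partial_cst addr0.
  have := partialM x i (smooth_coord c j) (smooth_coord c j).
  by rewrite partial_coord => h; apply: (eq_trans h); ring.
rewrite /square_deviation partial_sum; last first.
  by move=> j _; apply: (smoothD (g := cst (- moment T j))) => //; exact: smooth_cst.
case: ifPn => iI.
  rewrite (bigD1 i)//= dm eqxx mul1r big1 ?addr0// => j /andP[_ ji].
  by rewrite dm eq_sym (negbTE ji) mul0r.
rewrite big1// => j jI; rewrite dm (_ : (i == j) = false) ?mul0r//.
by apply: contraNF iI => /eqP ->.
Qed.

Lemma sum_mu_d_deltaE k s x A :
  \sum_(B : {set 'I_n} | #|B| == k) s B * mu_d_delta T k B x A =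
  if #|A| == k then s A * (- (k%:R / (n - k)%N%:R) * square_deviation (~: A) x
                           + square_deviation A x) else 0.
Proof.
have mE B : mu_d_delta T k B x A =
    (- (k%:R / (n - k)%N%:R) * square_deviation (~: B) x + square_deviation B x) * dx R B A.
  by rewrite /mu_d_delta /mu_d /mu_delta /bubble mulrDl mulrA.
under eq_bigr do rewrite mE mulrA.
case: ifPn => Ak.
  rewrite (bigD1 A)//= big1 ?addr0 => [|B /andP[_ BA]]; rewrite /dx.
    by rewrite eqxx mulr1.
  by rewrite eq_sym (negbTE BA) mulr0.
rewrite big1// => B Bk; rewrite /dx (_ : (A == B) = false) ?mulr0//.
by apply: contraNF Ak => /eqP ->.
Qed.

Lemma koszul_deltaE b x A : koszul_delta T (fun=> b) x A =
  (-1) ^+ inversions (~: A) *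
  koszul c (fun=> fun B => (-1) ^+ inversions (~: B) * b (~: B)) x (~: A).
Proof.
rewrite /koszul_delta hodgeE; congr (_ * koszul c _ x _).
by apply/funext => y; apply/funext => B; rewrite hodgeE.
Qed.

(** In d p the coefficient of (x^j - c^j) dx^(A + j) is a nonzero multiple of s_A,
    so every s_A vanishes, because k < n leaves an index j outside A.  Then
    d p = (k+1) a gives a = 0.  What is left is the star of a Whitney form whose
    linear part is determined by its codifferential. *)
Lemma Pddelta_harmonic_cst k p U x0 : (0 < k < n)%N -> Pddelta T k p ->
  open U -> U x0 -> (forall x, U x -> extd p x = fun=> 0) ->
  (forall x, U x -> codiff k p x = fun=> 0) ->
  exists2 a, homogeneous k a & p = fun=> a.
Proof.
move=> /andP[k0 kn] [P [a' [b' [s [hP ha hb pE]]]]] oU Ux0 dp cp.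
case: hP => kP [P' PE]; case: ha => ka [a aE]; case: hb => kb [b bE].
subst P a' b'.
have hP : homogeneous k P' := (kform_cst _ _).2 kP.
have ha : homogeneous k.+1 a := (kform_cst _ _).2 ka.
have hb : homogeneous k.-1 b := (kform_cst _ _).2 kb.
set b2 := fun B => (-1) ^+ inversions (~: B) * b (~: B).
have kn0 : k%:R / (n - k)%N%:R != 0 :> R.
  by rewrite mulf_neq0 ?invr_neq0// pnatr_eq0 -lt0n// subn_gt0.
pose r : R := - (k%:R / (n - k)%N%:R).
have pE' x A : p x A = P' A + koszul c (fun=> a) x A +
   (-1) ^+ inversions (~: A) * koszul c (fun=> b2) x (~: A) +
   (if #|A| == k then s A else 0) * (r * square_deviation (~: A) x + square_deviation A x).
  rewrite pE -koszul_deltaE.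
  transitivity (P' A + koszul c (fun=> a) x A + koszul_delta T (fun=> b) x A +
    \sum_(B : {set 'I_n} | #|B| == k) s B * mu_d_delta T k B x A) => //.
  by rewrite sum_mu_d_deltaE; case: ifP => //; rewrite mul0r.
pose w1 A x := P' A + koszul c (fun=> a) x A.
have sw1 A : smooth (w1 A) by exact: (smoothD (smooth_cst (P' A)) (smooth_koszul c a A)).
pose w2 A x := (-1) ^+ inversions (~: A) * koszul c (fun=> b2) x (~: A).
have sw2 A : smooth (w2 A) by apply: smoothZ; exact: smooth_koszul.
pose t A : R := if #|A| == k then s A else 0.
pose w3 A x := t A * (r * square_deviation (~: A) x + square_deviation A x).
have srq A : smooth (fun x => r * square_deviation (~: A) x).
  by apply: smoothZ; exact: smooth_square_deviation.
have sw3' A : smooth (fun x => r * square_deviation (~: A) x + square_deviation A x).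
  by apply: (smoothD (srq A)); exact: smooth_square_deviation.
have sw3 A : smooth (w3 A) by exact: smoothZ.
have pw A : p ^~ A = fun x => w1 A x + w2 A x + w3 A x.
  by apply/funext => x; rewrite pE'.
(* The coclosed Koszul part does not contribute: its coefficients at B minus i
   do not depend on x^i. *)
have dpE x B : extd p x B = #|B|%:R * a B +
    \sum_(i in B) (-1) ^+ before i B * (t (B :\ i) * (r * (2 * (x - c) ord0 i))).
  rewrite -(extd_koszul c a x) !extdE -big_split; apply: eq_bigr => i iB /=.
  rewrite -mulrDr; congr (_ * _); rewrite pw.
  rewrite (partialD (g := w3 (B :\ i)) x i (smoothD (sw1 _) (sw2 _)))//.
  rewrite (partialD (f := w1 _) (g := w2 _))//; congr (_ + _).
    rewrite partialD; [|exact: smooth_cst|exact: smooth_koszul].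
    rewrite partial_cst add0r partialZ; last exact: smooth_koszul.
    by rewrite [X in _ + _ * X]partial_koszul !inE eqxx/= mulr0 addr0.
  rewrite partialZ// partialD//; last exact: smooth_square_deviation.
  rewrite partialZ; last exact: smooth_square_deviation.
  by rewrite !partial_square_deviation !inE eqxx/= addr0.
have t0 A : t A = 0.
  rewrite /t; case: ifPn => // /eqP Ak.
  have [j jA] : exists j, j \notin A.
    apply/existsP; rewrite -negb_forall; apply/negP => /forallP h.
    have : #|A| = n by rewrite -[RHS]card_ord; apply: eq_card => j; rewrite h.
    lia.
  have := partial_eq0_open j oU Ux0 (f := fun x => extd p x (j |: A)).
  move=> /(_ (fun y Uy => congr1 (@^~ (j |: A)) (dp y Uy))).
  rewrite (_ : (fun _ => _) = (fun x => cst (#|j |: A|%:R * a (j |: A)) x +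
     \sum_(i in j |: A) ((-1) ^+ before i (j |: A) * (t ((j |: A) :\ i) * (r * 2))) *
       (x - c) ord0 i)); last first.
    apply/funext => x; rewrite dpE; congr (_ + _); apply: eq_bigr => i _; ring.
  rewrite partialD; [|exact: smooth_cst|]; last first.
    by apply: smooth_sum => i _; apply: smoothZ; exact: smooth_coord.
  rewrite partial_cst add0r partial_sum => [|i _]; last by apply: smoothZ; exact: smooth_coord.
  rewrite (bigD1 j) ?finset.setU11//= partialZ ?partial_coord; last exact: smooth_coord.
  rewrite eqxx mulr1 big1 ?addr0 => [|i /andP[_ ij]]; last first.
    rewrite partialZ ?partial_coord; last exact: smooth_coord.
    by rewrite eq_sym (negbTE ij) mulr0.
  rewrite finset.setU1K// /t Ak eqxx => /eqP; rewrite !mulf_eq0 signr_eq0/=.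
  by rewrite /r oppr_eq0 (negbTE kn0) pnatr_eq0 /= orbF => /eqP.
have a0 : a = fun=> 0.
  apply/funext => B; have [Bk|Bk] := eqVneq #|B| k.+1; last by rewrite ha.
  have := dpE x0 B; rewrite dp// big1 => [|i iB]; last by rewrite t0 mul0r mulr0.
  by rewrite addr0 Bk => /esym/eqP; rewrite mulf_eq0 pnatr_eq0/= => /eqP.
(* The inverse Hodge star of P', up to which p is the star of a Whitney form. *)
pose al A := (-1) ^+ inversions A * P' (~: A).
have pH : p = hodge (whitney c al b2).
  apply/funext => x; apply/funext => A.
  have := congr1 (@^~ x) (pw A) => /= ->.
  rewrite /w3 t0 mul0r addr0 /w1 a0 -[koszul _ _ _ _]/(koszul c (fun=> fun=> 0) x A).
  have -> : koszul c (fun=> fun=> 0) x A = 0 :> R.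
    by rewrite koszulE big1// => i _; rewrite mulr0 mul0r.
  rewrite addr0 hodgeE /whitney mulrDr /al finset.setCK mulrA signr_sq mul1r//.
have kE : k = k.-1.+1 by rewrite prednK.
have b20 : b2 = fun=> 0.
  apply/funext => C.
  have := congr1 (@^~ (~: C)) (cp x0 Ux0); rewrite pH [in codiff _]kE.
  rewrite hodge_whitney_codiff; last first.
  - move=> A Ak; rewrite /b2 hb ?mulr0//.
    apply: contraNneq Ak => h; have := cardsC A; rewrite card_ord; lia.
  - rewrite -kE => A Ak; rewrite /al hP ?mulr0//.
    apply: contraNneq Ak => h; have := cardsC A; rewrite card_ord; lia.
  - by rewrite -kE ltnW.
  rewrite hodgeE finset.setCK => /eqP; rewrite !mulf_eq0 !signr_eq0/= pnatr_eq0.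
  have -> : (n - k.-1 == 0)%N = false by lia.
  by move=> /= /eqP bC; rewrite /b2 bC mulr0.
exists P' => //; rewrite pH b20 whitney_cst; apply/funext => x; apply/funext => A.
by rewrite hodgeE /al finset.setCK mulrA signr_sq mul1r.
Qed.

End enriched_space.

(** * Barycentric coordinates of a simplex *)

Section barycentric_coordinates.
Variables (R : realType) (n : nat).
Implicit Types (x : 'rV[R]_n) (S T : {fset 'rV[R]_n}).

(** The vertices v_i of T together with affine functions
    lambda_i(x) = b_i + <a_i, x> satisfying lambda_i(v_j) = delta_ij. *)
Record barycentric T (v a : 'I_n.+1 -> 'rV[R]_n) (b : 'I_n.+1 -> R) : Prop := {
  bary_mem : forall x, x \in T <-> exists i, x = v i;
  bary_delta : forall i j, affine (a i) (b i) (v j) = (i == j)%:R;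
  bary_sum1 : forall x, \sum_i affine (a i) (b i) x = 1;
  bary_sum : forall x, \sum_i affine (a i) (b i) x *: v i = x }.

(** Affine independence says that the square matrix with rows (1, v_i) is
    invertible; its inverse contains the coefficients of the barycentric
    coordinates. *)
Lemma simplex_barycentric T : is_simplex T -> exists v a b, barycentric T v a b.
Proof.
move=> [sT indep].
pose v (i : 'I_n.+1) : 'rV[R]_n := nth 0 (enum_fset T) i.
have st : size (enum_fset T) = n.+1 by [].
pose one : 'rV[R]_1 := const_mx 1.
pose M : 'M[R]_n.+1 := \matrix_(i < n.+1) (row_mx one (v i)).
have sumT (V : nmodType) (F : 'rV[R]_n -> V) : \sum_(u <- T) F u = \sum_i F (v i).
  by rewrite (big_nth 0) st big_mkord.
have vi (i : 'I_n.+1) : index (v i) (enum_fset T) = i.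
  by rewrite index_uniq// ?st//; exact: fset_uniq.
have Mu : M \in unitmx.
  rewrite -row_free_unit; apply: inj_row_free => u uM.
  pose w x : R := u ord0 (inord (index x (enum_fset T))).
  have wv i : w (v i) = u ord0 i by rewrite /w vi inord_val.
  have uM' : \sum_i u ord0 i *: row_mx one (v i) = 0.
    apply/rowP => j; have := congr1 (fun A : 'rV[R]_(1 + n) => A ord0 j) uM.
    rewrite summxE !mxE => e; rewrite -[RHS]e; apply: eq_bigr => i _.
    by rewrite [LHS]mxE [M _ _]mxE.
  have h1 : \sum_(x <- T) w x = 0.
    rewrite sumT; have := congr1 (fun A : 'rV[R]_(1 + n) => A ord0 (lshift n (@ord0 0))) uM'.
    rewrite summxE mxE => e; rewrite -[RHS]e; apply: eq_bigr => i _.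
    by rewrite wv mxE row_mxEl mxE mulr1.
  have h2 : \sum_(x <- T) w x *: x = 0.
    rewrite sumT; apply/rowP => j.
    have := congr1 (fun A : 'rV[R]_(1 + n) => A ord0 (rshift 1 j)) uM'.
    rewrite !summxE !mxE => e; rewrite -[RHS]e; apply: eq_bigr => i _.
    by rewrite wv !mxE; case: splitP => [k|k /= /eqP]; [case: k => k hk /= jk; lia
      |rewrite eqSS => /eqP/val_inj ->].
  apply/rowP => i; rewrite mxE -wv; apply: (indep w h1 h2).
  by apply/(nthP 0); exists i => //; rewrite st.
pose a i : 'rV[R]_n := \row_j (invmx M) (rshift 1 j) i.
pose b i : R := (invmx M) (lshift n (@ord0 0)) i.
have abE x i : affine (a i) (b i) x = (row_mx one x *m (invmx M : 'M[R]_(1 + n, n.+1))) ord0 i.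
  rewrite mxE big_split_ord big_ord1 row_mxEl mxE mul1r; congr (_ + _).
  by apply: eq_bigr => j _; rewrite row_mxEr mxE mulrC.
have key x : \sum_i affine (a i) (b i) x *: row_mx one (v i) = row_mx one x.
  transitivity ((row_mx one x *m (invmx M : 'M[R]_(1 + n, n.+1))) *m M).
    apply/rowP => j; rewrite summxE [RHS]mxE; apply: eq_bigr => i _.
    by rewrite [LHS]mxE [M _ _]mxE abE.
  by rewrite -mulmxA (mulVmx Mu) mulmx1.
exists v, a, b; split.
- move=> x; split=> [/(nthP 0)[i]|[i ->]]; last by apply/(nthP 0); exists i => //; rewrite st.
  by rewrite st => ni <-; exists (Ordinal ni).
- move=> i j; rewrite abE.
  transitivity ((row j M *m invmx M) ord0 i).
    rewrite mxE [RHS]mxE; apply: eq_bigr => l _.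
    by rewrite [row j M _ _]mxE [M _ _]mxE.
  by rewrite -row_mul (mulmxV Mu) !mxE eq_sym.
- move=> x; have := congr1 (fun A : 'rV[R]_(1 + n) => A ord0 (lshift n (@ord0 0))) (key x).
  rewrite summxE row_mxEl mxE => <-; apply: eq_bigr => i _.
  by rewrite mxE row_mxEl mxE mulr1.
- move=> x; apply/rowP => j; have := congr1 (fun A : 'rV[R]_(1 + n) => A ord0 (rshift 1 j)) (key x).
  rewrite !summxE row_mxEr => <-; apply: eq_bigr => i _.
  by rewrite [in RHS]mxE row_mxEr mxE.
Qed.

Lemma affine_sum a c (I : Type) (r : seq I) (w : I -> R) (u : I -> 'rV[R]_n) :
  \sum_(i <- r) w i = 1 ->
  affine a c (\sum_(i <- r) w i *: u i) = \sum_(i <- r) w i * affine a c (u i).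
Proof.
move=> w1; rewrite /affine; under [RHS]eq_bigr do rewrite mulrDr.
rewrite big_split/= -mulr_suml w1 mul1r; congr (_ + _).
under [RHS]eq_bigr do rewrite mulr_sumr.
rewrite exchange_big/=; apply: eq_bigr => j _; rewrite summxE mulr_sumr.
by apply: eq_bigr => i _; rewrite mxE mulrCA.
Qed.

Section simplex.
Variables (T : {fset 'rV[R]_n}) (v a : 'I_n.+1 -> 'rV[R]_n) (b : 'I_n.+1 -> R).
Hypothesis bT : barycentric T v a b.
Let lam i := affine (a i) (b i).

Lemma hull_sub_ge0 S x i : {subset S <= T} -> hull S x -> 0 <= lam i x.
Proof.
move=> ST [w [w0 w1 ->]]; rewrite /lam affine_sum// big_seq sumr_ge0// => u uS.
have /(bary_mem bT)[j uj] := ST _ uS.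
by rewrite mulr_ge0 ?w0// uj (bary_delta bT).
Qed.

(** A face lies in the hyperplane lambda_i = 0 of each vertex v_i that it misses.
    This separates distinct cells. *)
Lemma hull_sub_eq0 S x i : {subset S <= T} -> v i \notin S -> hull S x -> lam i x = 0.
Proof.
move=> ST viS [w [w0 w1 ->]]; rewrite /lam affine_sum// big_seq big1// => u uS.
have /(bary_mem bT)[j uj] := ST _ uS.
rewrite uj (bary_delta bT) (_ : (i == j) = false) ?mulr0//.
by apply: contraNF viS => /eqP ->; rewrite -uj.
Qed.

Lemma hullE : hull T = [set x | forall i, 0 <= lam i x].
Proof.
apply/seteqP; split => x /= h; first by move=> i; apply: hull_sub_ge0 h.
have sumE (V : lmodType R) (F : 'rV[R]_n -> V) i : \sum_(u <- T) (u == v i)%:R *: F u = F (v i).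
  rewrite (bigD1_seq (v i)) ?fset_uniq//=; last by apply/(bary_mem bT); exists i.
  by rewrite eqxx scale1r big1 ?addr0// => u /negbTE ->; rewrite scale0r.
exists (fun u => \sum_i lam i x * (u == v i)%:R); split.
- by move=> u uT; apply: sumr_ge0 => i _; rewrite mulr_ge0.
- rewrite exchange_big/=; apply: etrans (bary_sum1 bT x); apply: eq_bigr => i _.
  rewrite -mulr_sumr -[RHS]mulr1; congr (_ * _).
  apply: etrans (sumE R^o (fun=> 1) i); apply: eq_bigr => u _.
  by rewrite -[LHS]mulr1.
- under eq_bigr do rewrite scaler_suml.
  rewrite exchange_big/= -[LHS](bary_sum bT x); apply: eq_bigr => i _.
  rewrite -[X in _ *: X](sumE _ id i) scaler_sumr; apply: eq_bigr => u _.
  by rewrite scalerA.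
Qed.

Lemma bary_gradient_neq0 i : (0 < n)%N -> exists j, a i ord0 j != 0.
Proof.
move=> n0; apply: contrapT => h.
have ai j : a i ord0 j = 0 by apply/eqP/negP => /negP aj; apply: h; exists j.
have lc x : lam i x = b i by rewrite /lam /affine big1 ?addr0// => j _; rewrite ai mul0r.
have [k ki] : exists k : 'I_n.+1, k != i.
  have [i0|i0] := eqVneq i ord0; [exists ord_max|by exists ord0; rewrite eq_sym].
  by rewrite i0 -val_eqE/= -lt0n.
have := bary_delta bT i k; have := bary_delta bT i i.
rewrite -/(lam i) !lc eqxx eq_sym (negbTE ki) => -> /eqP; by rewrite oner_eq0.
Qed.

Lemma affine_line c d x (h : R) y : affine c d (x + h *: y) = affine c d x + h * affine c 0 y.
Proof. by rewrite affineD affine0Z. Qed.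

Lemma bary_edge i j k : affine (a i) 0 (v j - v k) = (i == j)%:R - (i == k)%:R.
Proof.
have := affineD (a i) (b i) (v k) (v j - v k).
by rewrite (addrC (v k)) subrK !(bary_delta bT) => ->; rewrite addrAC subrr add0r.
Qed.

(** At a point of the hull with lambda_i = 0, moving in the direction v_k - v_i
    makes lambda_i negative. *)
Lemma bary_interior : interior (hull T) = [set x | forall i, 0 < lam i x].
Proof.
apply/seteqP; split => x /=; last first.
  move=> lx; rewrite hullE /interior/=.
  have lnear i : \forall y \near x, 0 < lam i y.
    have := (@continuous_affine R n (a i) (b i) x).
    move=> /(_ [set t | 0 < t]); apply; apply: open_nbhs_nbhs.
    by split; [exact: open_gt|exact: lx].
  near=> y => i; apply: ltW; move: i; near: y; exact: filter_forall.
move=> xi i; have xh : hull T x by exact: interior_subset.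
rewrite lt_neqAle; apply/andP; split; last by move: xh; rewrite hullE.
apply/negP => /eqP li0.
have [n0|n0] := posnP n.
  have := bary_sum1 bT x; rewrite (bigD1 i)//= -/(lam i x) -li0 big1 => [|j ji].
    by rewrite addr0 => /eqP; rewrite eq_sym oner_eq0.
  have all0 (l : 'I_n.+1) : nat_of_ord l = 0%N.
    by apply/eqP; rewrite -leqn0 -[X in (_ <= X)%N]n0 -ltnS ltn_ord.
  by move: ji; rewrite -val_eqE/= !all0.
have [k ki] : exists k : 'I_n.+1, k != i.
  have [i0|i0] := eqVneq i ord0; [exists ord_max|by exists ord0; rewrite eq_sym].
  by rewrite i0 -val_eqE/= -lt0n.
have [e /= e0 be] : exists2 e : R, 0 < e & hull T (x + e *: (v k - v i)).
  have /nbhs_ballP[d /= d0 bd] : nbhs x (hull T) by [].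
  pose N := `|v k - v i| + 1.
  have N0 : 0 < N by rewrite ltr_wpDl.
  exists (d / N / 2); first by rewrite !divr_gt0.
  apply: bd; rewrite -ball_normE/= opprD addrA subrr add0r normrN normrZ.
  rewrite ger0_norm ?divr_ge0 ?ltW// mulrAC ltr_pdivrMr// mulrAC ltr_pdivrMr//.
  have : d * `|v k - v i| <= d * N by apply: ler_wpM2l; [exact: ltW|rewrite /N lerDl].
  have : 0 < d * N by rewrite mulr_gt0.
  lra.
have := hull_sub_ge0 i (fun _ => id) be.
rewrite /lam affine_line -/(lam i x) -li0 add0r bary_edge eqxx eq_sym (negbTE ki).
by rewrite sub0r mulrN1 oppr_ge0 leNgt e0.
Unshelve. all: by end_near. Qed.

Lemma bary_interior_neq0 : exists x, interior (hull T) x.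
Proof.
exists (\sum_i (n.+1%:R^-1 : R) *: v i); rewrite bary_interior => i /=.
rewrite /lam affine_sum; last first.
  by rewrite sumr_const card_ord -[LHS]mulr_natl divff// pnatr_eq0.
rewrite (bigD1 i)//= (bary_delta bT) eqxx mulr1 big1 ?addr0 ?invr_gt0//.
by move=> j ji; rewrite (bary_delta bT) eq_sym (negbTE ji) mulr0.
Qed.

Lemma hull_bounded : exists M : R, forall x, hull T x -> forall j, `|x ord0 j| < M.
Proof.
exists (1 + \sum_i \sum_j `|v i ord0 j|) => x hx j.
rewrite ltr_pwDl// -[x in leLHS](bary_sum bT) summxE.
apply: le_trans (ler_norm_sum _ _ _) _; apply: ler_sum => i _.
rewrite mxE normrM; apply: le_trans (_ : _ <= `|v i ord0 j|) _; last first.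
  by rewrite (bigD1 j)//= lerDl sumr_ge0.
have l0 k : 0 <= lam k x by apply: hull_sub_ge0 hx.
rewrite ler_piMl// -/(lam i x) ger0_norm// -(bary_sum1 bT x) (bigD1 i)//= lerDl.
by apply: sumr_ge0 => k _; exact: l0.
Qed.

Lemma hull_closed : closed (hull T).
Proof.
rewrite hullE (_ : [set _ | _] = \bigcap_i (lam i @^-1` [set t | 0 <= t])).
  apply: closed_bigI => i _; apply: closed_comp; last exact: closed_ge.
  by move=> x _; exact: continuous_affine.
by apply/seteqP; split => x /= h i; [move=> _; exact: h|exact: h].
Qed.

End simplex.
End barycentric_coordinates.

(** * Integration over subsets of row vectors *)

Section row_integration.
Variables (R : realType) (n : nat).
Implicit Types (D O : set 'rV[R]_n) (f g : 'rV[R]_n -> R).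
Local Notation pre D := (@rV_of_tuple R n @^-1` D).
Local Notation leb := (lebesgue_tuple R n).

Definition integrable_rV D f : Prop :=
  leb.-integrable (pre D) (fun t => (f (rV_of_tuple t))%:E).

(** Boundedness in the form that matches [open_box] and the support conditions
    of the integration lemmas. *)
Definition box_bounded D := exists M : R, forall x, D x -> forall j, `|x ord0 j| < M.

Lemma eq_integral_rV D f g : (forall x, D x -> f x = g x) ->
  integral_rV D f = integral_rV D g.
Proof. by move=> fg; apply: eq_Rintegral => t; rewrite inE => /fg. Qed.

Lemma integral_rVD D f g : measurable (pre D) -> integrable_rV D f -> integrable_rV D g ->
  integral_rV D (fun x => f x + g x) = integral_rV D f + integral_rV D g.
Proof. by move=> mD fi gi; exact: RintegralD. Qed.

Lemma integral_rVB D f g : measurable (pre D) -> integrable_rV D f -> integrable_rV D g ->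
  integral_rV D (fun x => f x - g x) = integral_rV D f - integral_rV D g.
Proof. by move=> mD fi gi; exact: RintegralB. Qed.

Lemma integrable_rVB D f g : measurable (pre D) -> integrable_rV D f -> integrable_rV D g ->
  integrable_rV D (fun x => f x - g x).
Proof. by move=> mD fi gi; apply: eq_integrable (integrableB mD fi gi). Qed.

Lemma integral_rVZ D (c : R) f : measurable (pre D) -> integrable_rV D f ->
  integral_rV D (fun x => c * f x) = c * integral_rV D f.
Proof. by move=> mD fi; exact: RintegralZl. Qed.

Lemma integrable_rVZ D (c : R) f : measurable (pre D) -> integrable_rV D f ->
  integrable_rV D (fun x => c * f x).
Proof. by move=> mD fi; apply: eq_integrable (integrableZl mD c fi). Qed.

Lemma integral_rV0 D : integral_rV D (fun=> 0) = 0.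
Proof. by rewrite /integral_rV /Rintegral integral0. Qed.

Lemma integrable_rV_sum D (I : Type) (r : seq I) (P : pred I) (F : I -> 'rV[R]_n -> R) :
  measurable (pre D) -> (forall i, P i -> integrable_rV D (F i)) ->
  integrable_rV D (fun x => \sum_(i <- r | P i) F i x).
Proof.
move=> mD Fi; have := integrable_sum (mu := leb) mD r Fi.
by apply: eq_integrable => // t _; rewrite sumEFin.
Qed.

Lemma integral_rV_sum D (I : Type) (r : seq I) (P : pred I) (F : I -> 'rV[R]_n -> R) :
  measurable (pre D) -> (forall i, P i -> integrable_rV D (F i)) ->
  integral_rV D (fun x => \sum_(i <- r | P i) F i x) = \sum_(i <- r | P i) integral_rV D (F i).
Proof.
move=> mD Fi; elim: r => [|i r IH].
  by rewrite big_nil; apply: etrans (integral_rV0 D); apply: eq_integral_rV => x _; rewrite big_nil.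
rewrite big_cons -IH; case: ifPn => Pi; last first.
  by apply: eq_integral_rV => x _; rewrite big_cons (negbTE Pi).
rewrite -integral_rVD//; [|exact: Fi|exact: integrable_rV_sum].
by apply: eq_integral_rV => x _; rewrite big_cons Pi.
Qed.

Lemma box_bounded_lty D : measurable (pre D) -> box_bounded D -> (leb (pre D) < +oo)%E.
Proof.
move=> mD [M DM]; apply: le_lt_trans (open_box_lty n M).
apply: le_measure; rewrite ?inE//; first exact: measurable_open_box.
by move=> t /DM h i; have := h i; rewrite sub0r normrN mxE.
Qed.

Lemma bounded_integrable_rV D f : measurable (pre D) -> box_bounded D ->
  measurable_fun (pre D) (fun t => f (rV_of_tuple t)) ->
  (exists C, forall x, D x -> `|f x| <= C) -> integrable_rV D f.
Proof.
move=> mD bD mf [C fC]; apply: measurable_bounded_integrable => //.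
  exact: box_bounded_lty.
exists C; split; first exact: num_real.
by move=> y Cy t Dt; exact: le_trans (fC _ Dt) (ltW Cy).
Qed.

Lemma continuous_bounded D f : box_bounded D -> continuous f ->
  exists C, forall x, D x -> `|f x| <= C.
Proof.
move=> [M DM] cf; have [C fC] := continuous_bounded_box M cf.
by exists C => x /DM h; apply: fC => j; exact: ltW.
Qed.

Lemma continuous_integrable_rV D f : measurable (pre D) -> box_bounded D ->
  continuous f -> integrable_rV D f.
Proof.
move=> mD bD cf; apply: bounded_integrable_rV => //.
  by apply: measurable_funTS; exact: measurable_fun_continuous_rV cf.
exact: continuous_bounded.
Qed.

Lemma measure_open_gt0 O x : open O -> O x -> (0 < leb (pre O))%E.
Proof.
move=> oO Ox; have /nbhs_ballP[e /= e0 be] : nbhs x O by exact: open_nbhs_nbhs.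
apply: (@lt_le_trans _ _ (leb (open_box (fun i => x ord0 i) e))).
  by rewrite measure_open_box// lte_fin exprn_gt0// mulr_gt0.
apply: le_measure; rewrite ?inE; [exact: measurable_open_box|exact: measurable_open_rV|].
move=> t ht; apply: be; split => // i j; rewrite ord1 /ball/= mxE; exact: ht.
Qed.

Lemma volume_gt0 O x : open O -> O x -> box_bounded O -> 0 < integral_rV O (fun=> 1).
Proof.
move=> oO Ox bO; rewrite /integral_rV Rintegral_cst ?mul1r; last exact: measurable_open_rV.
by apply: fine_gt0; rewrite (measure_open_gt0 oO Ox)// box_bounded_lty//; exact: measurable_open_rV.
Qed.

Lemma negligible_affine (a : 'rV[R]_n) (c : R) : (exists j, a ord0 j != 0) ->
  leb.-negligible (pre [set x | affine a c x = 0]).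
Proof.
move=> a0; have mA : measurable (pre [set x | affine a c x = 0]).
  rewrite (_ : _ @^-1` _ = ~` (pre [set x | affine a c x != 0])).
    apply: measurableC; apply: measurable_open_rV.
    rewrite (_ : [set _ | _] = affine a c @^-1` [set t | t != 0])//.
    move/continuousP : (@continuous_affine R n a c); apply.
    exact: open_neq.
  apply/seteqP; split => t /=; first by move=> ->; rewrite eqxx.
  by move=> /negP; rewrite negbK => /eqP.
apply/negligibleP => //.
apply: etrans (null_hyperplane (- c) a0); congr (leb _).
have aE t : affine a c (rV_of_tuple t) = c + \sum_i a ord0 i * tnth t i.
  by congr (_ + _); apply: eq_bigr => i _; rewrite mxE.
apply/seteqP; split => t /=; rewrite aE.
  by move/eqP; rewrite addrC addr_eq0 => /eqP.
by move=> ->; rewrite subrr.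
Qed.

Lemma negligible_bigU (I : Type) (r : seq I) (F : I -> set (n.-tuple (measurableTypeR R))) :
  (forall i, leb.-negligible (F i)) -> leb.-negligible (\big[setU/set0]_(i <- r) F i).
Proof.
move=> nF; elim: r => [|i r IH]; first by rewrite big_nil; exact: negligible_set0.
by rewrite big_cons; exact: negligibleU.
Qed.

Lemma integral_rV_negligible D N f : measurable (pre D) -> measurable (pre N) ->
  leb.-negligible (pre N) -> integrable_rV D f ->
  integral_rV D f = integral_rV (D `\` N) f.
Proof.
move=> mD mN nN fi; rewrite /integral_rV /Rintegral; congr fine.
by rewrite (negligible_integral (N := pre N))//; exact: measure_negligible.
Qed.

End row_integration.

(** * Cells of a simplicial subdivision *)

Section mesh.
Variables (R : realType) (n : nat).
Hypothesis n_gt0 : (0 < n)%N.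
Implicit Types (S T : {fset 'rV[R]_n}) (f g : 'rV[R]_n -> R).
Local Notation pre D := (@rV_of_tuple R n @^-1` D).
Local Notation leb := (lebesgue_tuple R n).

Definition cell T := interior (hull T).

Lemma open_cell T : open (cell T).
Proof. exact: open_interior. Qed.

Lemma measurable_cell T : measurable (pre (cell T)).
Proof. by apply: measurable_open_rV; exact: open_cell. Qed.

Lemma box_bounded_hull T : is_simplex T -> box_bounded (hull T).
Proof. by move=> /simplex_barycentric[v [a [b bT]]]; exact: (hull_bounded bT). Qed.

Lemma box_bounded_cell T : is_simplex T -> box_bounded (cell T).
Proof.
move=> /box_bounded_hull[M hM]; exists M => x /interior_subset; exact: hM.
Qed.

Lemma cell_neq0 T : is_simplex T -> exists x, cell T x.
Proof. by move=> /simplex_barycentric[v [a [b bT]]]; exact: (bary_interior_neq0 bT). Qed.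

Lemma measurable_hull T : is_simplex T -> measurable (pre (hull T)).
Proof.
move=> /simplex_barycentric[v [a [b bT]]].
rewrite (_ : pre (hull T) = ~` (pre (~` hull T))); last by rewrite preimage_setC setCK.
apply: measurableC; apply: measurable_open_rV.
exact: closed_openC (hull_closed bT).
Qed.

Lemma negligible_hull_boundary T : is_simplex T ->
  leb.-negligible (pre (hull T `\` cell T)).
Proof.
move=> /simplex_barycentric[v [a [b bT]]].
apply: (negligibleS (A := \big[setU/set0]_(i <- enum 'I_n.+1)
    pre [set x | affine (a i) (b i) x = 0])).
  move=> t /=; rewrite /cell (bary_interior bT) (hullE bT) => -[h1 /existsNP[i h2]].
  rewrite -bigcup_seq; exists i => /=; first by rewrite mem_enum.
  by apply/eqP; rewrite eq_le h1 andbT leNgt; exact/negP.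
by apply: negligible_bigU => i; apply: negligible_affine; exact: (bary_gradient_neq0 bT).
Qed.

Lemma integral_hull T f : is_simplex T -> integrable_rV (hull T) f ->
  integral_rV (hull T) f = integral_rV (cell T) f.
Proof.
move=> sT fi; rewrite (integral_rV_negligible (N := hull T `\` cell T))//.
- by rewrite setDD setIidr//; exact: interior_subset.
- exact: measurable_hull.
- apply: (@measurableD _ _ (pre (hull T)) (pre (cell T))); last exact: measurable_cell.
  exact: measurable_hull.
- exact: negligible_hull_boundary.
Qed.

Lemma cell_volume_gt0 T : is_simplex T -> 0 < integral_rV (cell T) (fun=> 1).
Proof.
move=> sT; have [x cx] := cell_neq0 sT.
by apply: volume_gt0 cx _; [exact: open_cell|exact: box_bounded_cell].
Qed.

(** The mean is taken over the closed simplex, but its boundary is negligible. *)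
Lemma mean_cell T f : is_simplex T -> continuous f ->
  mean T f * integral_rV (cell T) (fun=> 1) = integral_rV (cell T) f.
Proof.
move=> sT cf.
have ih g : continuous g -> integrable_rV (hull T) g.
  move=> cg; apply: continuous_integrable_rV cg;
    [exact: measurable_hull|exact: box_bounded_hull].
rewrite /mean !integral_hull//; [|by apply: ih; exact: cst_continuous|exact: ih].
by rewrite divfK// gt_eqF// cell_volume_gt0.
Qed.

Lemma integral_barycenter T i : is_simplex T ->
  integral_rV (cell T) (fun x => (x - barycenter T) ord0 i) = 0.
Proof.
move=> sT; pose V := integral_rV (cell T) (fun=> 1).
have ccoord : continuous (fun x : 'rV[R]_n => x ord0 i) by exact: coord_continuous.
have ccst c : continuous (fun _ : 'rV[R]_n => c : R) by exact: cst_continuous.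
have int f : continuous f -> integrable_rV (cell T) f.
  move=> cf; apply: continuous_integrable_rV cf;
    [exact: measurable_cell|exact: box_bounded_cell].
transitivity (integral_rV (cell T) (fun x => x ord0 i - mean T (fun x => x ord0 i) * 1)).
  by apply: eq_integral_rV => x _; rewrite !mxE mulr1.
rewrite integral_rVB; [|exact: measurable_cell|exact: int|by apply: int; exact: ccst].
rewrite integral_rVZ; [|exact: measurable_cell|by apply: int; exact: ccst].
by rewrite mean_cell// subrr.
Qed.

Section subdivision.
Variables (Omega : set 'rV[R]_n) (G : {fset {fset 'rV[R]_n}}).
Hypothesis oOmega : open Omega.
Hypothesis regular : interior (closure Omega) = Omega.
Hypothesis subdiv : simplicial_subdivision Omega G.

Lemma mesh_simplex T : T \in G -> is_simplex T.
Proof. by case: subdiv => h _ _; exact: h. Qed.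

Lemma cell_sub T : T \in G -> cell T `<=` Omega.
Proof.
move=> TG; rewrite -regular; apply: interiorS => x hx.
by case: subdiv => _ -> _; exists T.
Qed.

(** The common points lie in the hull of a common proper face, where one of the
    barycentric coordinates of S vanishes. *)
Lemma cell_disjoint S T x : S \in G -> T \in G -> cell S x -> cell T x -> S = T.
Proof.
move=> SG TG xS xT; apply: contrapT => ST.
have [sS sT] : #|` S| = n.+1 /\ #|` T| = n.+1.
  by split; [case: (mesh_simplex SG)|case: (mesh_simplex TG)].
have [v [a [b bS]]] := simplex_barycentric (mesh_simplex SG).
have : ~~ (S `<=` T)%fset.
  apply/negP => sub; apply: ST; apply/eqP; rewrite -(fsubset_leqif_cards sub).
  by rewrite sS sT.
move=> /fsubsetPn[u uS uT].
have /(bary_mem bS)[i ui] := uS.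
have xST : hull (S `&` T)%fset x.
  by case: subdiv => _ _ <- //; split; exact: interior_subset.
have sub : {subset (S `&` T)%fset <= S} by move=> y; rewrite inE => /andP[].
have vi : v i \notin (S `&` T)%fset by rewrite -ui inE (negbTE uT) andbF.
have := hull_sub_eq0 bS sub vi xST.
move: xS; rewrite /cell (bary_interior bS) => /(_ i) /=.
by move=> h e; move: h; rewrite e ltxx.
Qed.

Lemma box_bounded_Omega : box_bounded Omega.
Proof.
have bh (r : seq {fset 'rV[R]_n}) : {subset r <= G} ->
    exists M : R, forall T, T \in r -> forall x, hull T x -> forall j, `|x ord0 j| < M.
  elim: r => [|S r IH] sub; first by exists 0.
  have [M hM] : exists M : R, forall T, T \in r -> forall x, hull T x -> forall j, `|x ord0 j| < M.
    by apply: IH => T Tr; apply: sub; rewrite inE Tr orbT.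
  have [N hN] := box_bounded_hull (mesh_simplex (sub S (mem_head _ _))).
  exists (Num.max N M) => T; rewrite inE => /orP[/eqP ->|Tr] x hx j.
    by rewrite lt_max hN.
  by rewrite lt_max (hM T)// orbT.
have [M hM] := bh (enum_fset G) (fun _ => id).
exists M => x xO j; have : closure Omega x by exact: subset_closure.
by case: subdiv => _ -> _ [T TG hx]; exact: (hM T).
Qed.

(** The closed simplices cover the closure of the domain and their boundaries are
    negligible. *)
Lemma integral_mesh f : integrable_rV Omega f ->
  integral_rV Omega f = \sum_(T <- G) integral_rV (cell T) f.
Proof.
move=> fi.
pose U := \big[setU/set0]_(T <- enum_fset G) pre (cell T).
have mU : measurable U by apply: bigsetU_measurable => T _; exact: measurable_cell.
have UE : U = pre (cells G).
  rewrite /U -bigcup_seq; apply/seteqP; split => t [T /= TG Tt]; by exists T.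
have iU : leb.-integrable U (fun t => (f (rV_of_tuple t))%:E).
  apply: integrableS fi => //; first exact: measurable_open_rV.
  by rewrite UE => t [T TG]; exact: cell_sub.
have mO : measurable (pre Omega) by exact: measurable_open_rV.
rewrite (integral_rV_negligible (N := Omega `\` cells G))//.
- rewrite setDD setIidr => [|x [T TG]]; last exact: cell_sub.
  rewrite /integral_rV /Rintegral -UE integral_bigsetU_EFin//.
  + rewrite [in LHS]big_seq [RHS]big_seq sum_fine// => T TG.
    apply: integrable_fin_num; first exact: measurable_cell.
    apply: integrableS fi => //; first exact: measurable_cell.
    by move=> t; exact: cell_sub.
  + by move=> T; exact: measurable_cell.
  + move=> S T /= SG TG [t [tS tT]]; exact: cell_disjoint tS tT.
  + by case/integrableP : iU.
- have -> : pre (Omega `\` cells G) = pre Omega `\` U by rewrite UE.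
  exact: measurableD.
- apply: (negligibleS (A := \big[setU/set0]_(T <- enum_fset G)
     (if T \in G then pre (hull T `\` cell T) else set0))).
    move=> t [Ot nt]; have : closure Omega (rV_of_tuple t) by exact: subset_closure.
    case: subdiv => _ -> _ [T TG hx]; rewrite -bigcup_seq; exists T => //=.
    rewrite ifT//; split => // ct; apply: nt; by exists T.
  apply: negligible_bigU => T; case: ifPn => [TG|_]; last exact: negligible_set0.
  exact/negligible_hull_boundary/mesh_simplex.
Qed.

End subdivision.
End mesh.

(** * Lipschitz domains *)

Section lipschitz_domain.
Variables (R : realType) (n : nat).

Lemma continuous_mulmx_coord (Q : 'M[R]_n) (j : 'I_n) :
  continuous (fun z : 'rV[R]_n => (z *m Q) ord0 j).
Proof.
rewrite (_ : (fun _ => _) = affine (\row_l Q l j) 0); first exact: continuous_affine.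
apply/funext => z; rewrite /affine add0r mxE; apply: eq_bigr => l _.
by rewrite mxE mulrC.
Qed.

Lemma lipschitz_comp_continuous m (gamma : 'rV[R]_m -> R) (L : R)
    (h : 'rV[R]_n -> 'rV[R]_m) :
  L.-lipschitz gamma -> (forall j, continuous (fun z => h z ord0 j)) ->
  continuous (gamma \o h).
Proof.
move=> Lg ch x.
apply/(@cvgrPdist_lt _ _ _ (nbhs x) _ (gamma \o h) (gamma (h x))) => e e0 /=.
pose K := `|L| + 1; have K0 : 0 < K by rewrite ltr_wpDl.
have near_h : \forall z \near x, ball (h x) (e / K) (h z).
  have hj (j : 'I_m) : \forall z \near x, `|h x ord0 j - h z ord0 j| < e / K.
    by have := ch j x => /cvgrPdist_lt; apply; exact: divr_gt0.
  near=> z; split; first exact: divr_gt0.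
  move=> i j; rewrite ord1 /ball/=; move: j; near: z; exact: (@filter_forall _ _ _ _ _ hj).
near=> z; apply: le_lt_trans (Lg (h x, h z) (conj I I)) _ => /=.
have : ball (h x) (e / K) (h z) by near: z.
rewrite -ball_normE/= => hb.
apply: le_lt_trans (_ : _ <= `|L| * `|h x - h z|) _.
  by rewrite ler_wpM2r// ler_norm.
apply: (@le_lt_trans _ _ (K * `|h x - h z|)); first by rewrite ler_wpM2r// lerDl.
by rewrite -ltr_pdivlMl// mulrC.
Unshelve. all: by end_near. Qed.

(** A boundary point lies on or below the graph.  Points slightly below it are
    strictly below the graph, hence have a neighborhood outside the domain, so
    the boundary point is not interior to the closure. *)
Lemma interior_closure_lipschitz (Omega : set 'rV[R]_n) :
  bounded_lipschitz_domain Omega -> interior (closure Omega) = Omega.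
Proof.
move=> [oO _ _ _ lip]; apply/seteqP; split => x; last first.
  by move=> Ox; apply: filterS (@subset_closure _ Omega) _; exact: open_nbhs_nbhs.
move=> ix; apply: contrapT => nOx.
have [Q [i [gamma [L [QQ Lg gr]]]]] := lip x (interior_subset ix) nOx.
pose g (z : 'rV[R]_n) := gamma (col' i (z *m Q)) - (z *m Q) ord0 i.
have cg : continuous g.
  move=> z; apply: continuousB; last exact: continuous_mulmx_coord.
  apply: (@lipschitz_comp_continuous _ gamma L (fun z => col' i (z *m Q))) => // j.
  rewrite (_ : (fun _ => _) = (fun z : 'rV[R]_n => (z *m Q) ord0 (lift i j))).
    exact: continuous_mulmx_coord.
  by apply/funext => y; rewrite mxE.
pose d : 'rV[R]_n := 'e_i *m Q^T.
have dQ : d *m Q = 'e_i by rewrite -mulmxA (mulmx1C QQ) mulmx1.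
have gx : 0 <= g x.
  rewrite subr_ge0 leNgt; apply/negP => gO; apply: nOx.
  by apply/(nbhs_singleton gr).
have gd t : g (x - t *: d) = g x + t.
  rewrite /g mulmxBl -scalemxAl dQ.
  rewrite (_ : col' i _ = col' i (x *m Q)); last first.
    apply/rowP => j; rewrite !mxE eqxx/= eq_sym (negbTE (neq_lift _ _)).
    by rewrite mulr0 subr0.
  by rewrite !mxE !eqxx mulr1 opprB addrCA addrC.
have /nbhs_ballP[e /= e0 be] : nbhs x (closure Omega `&`
    [set y | Omega y <-> gamma (col' i (y *m Q)) < (y *m Q) ord0 i]).
  by apply: filterI.
(* x - t d is x moved down by t in the rotated coordinates; t is chosen so
   that it stays in the ball. *)
pose t := e / (`|d| + 1) / 2.
have d0 : 0 < `|d| + 1 by rewrite ltr_wpDl.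
have t0 : 0 < t by rewrite !divr_gt0.
have xt : ball x e (x - t *: d).
  rewrite -ball_normE/= opprB addrC subrK normrZ gtr0_norm// /t.
  rewrite mulrAC ltr_pdivrMr// mulrAC ltr_pdivrMr//.
  have : 0 < e * (`|d| + 1) by rewrite mulr_gt0.
  have : e * `|d| <= e * (`|d| + 1) by apply: ler_wpM2l; [exact: ltW|rewrite lerDl].
  lra.
have [clt _] := be _ xt.
have [z [Oz [bz gz]]] : Omega `&` (ball x e `&` [set z | 0 < g z]) !=set0.
  apply: clt; apply: filterI.
    by apply: open_nbhs_nbhs; split => //; exact: ball_open.
  have := cg (x - t *: d) [set s | 0 < s]; apply; apply: open_nbhs_nbhs.
  by split; [exact: open_gt|rewrite /= gd ltr_wpDl].
have [_ /= [h _]] := be _ bz.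
by have := h Oz; rewrite -subr_lt0 -/(g z) ltNge ltW.
Qed.

End lipschitz_domain.

(** * Square-integrable forms *)

Section square_integrable.
Variables (R : realType) (n : nat) (Omega : set 'rV[R]_n).
Hypothesis oOmega : open Omega.
Hypothesis bOmega : box_bounded Omega.
Implicit Types (omega eta tau phi p : dform R n) (A B : {set 'I_n}) (k : nat).
Local Notation pre D := (@rV_of_tuple R n @^-1` D).

Lemma measurable_Omega : measurable (pre Omega).
Proof. exact: measurable_open_rV. Qed.
Local Hint Resolve measurable_Omega : core.

Lemma L2form_integrableM k l omega eta A B :
  L2form Omega k omega -> L2form Omega l eta ->
  integrable_rV Omega (fun x => omega x A * eta x B).
Proof.
move=> [_ /(_ A)[mo io]] [_ /(_ B)[me ie]].
apply: le_integrable (integrableD measurable_Omega io ie) => //.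
  by apply/measurable_EFinP; exact: measurable_funM.
move=> t _ /=; rewrite lee_fin.
set u := omega _ _; set w := eta _ _.
rewrite ler_norml [X in _ && (_ <= X)]ger0_norm ?addr_ge0 ?sqr_ge0//.
rewrite [X in - X]ger0_norm ?addr_ge0 ?sqr_ge0//.
have := sqr_ge0 (u + w); have := sqr_ge0 (u - w).
have := sqr_ge0 u; have := sqr_ge0 w; lra.
Qed.

Lemma dotf_integrable k l omega eta :
  L2form Omega k omega -> L2form Omega l eta -> integrable_rV Omega (dotf omega eta).
Proof.
move=> ho he; apply: integrable_rV_sum => // A _; exact: L2form_integrableM ho he.
Qed.

Lemma bounded_L2form k omega : kform k omega ->
  (forall A, measurable_fun (pre Omega) (fun t => omega (rV_of_tuple t) A)) ->
  (forall A, exists C, forall x, Omega x -> `|omega x A| <= C) ->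
  L2form Omega k omega.
Proof.
move=> ko mo bo; split => // A; split => //.
apply: (@bounded_integrable_rV _ _ Omega (fun x => omega x A ^+ 2)) => //.
  exact: measurable_funX.
have [C oC] := bo A; exists (C ^+ 2) => x Ox; rewrite normrX.
by rewrite lerXn2r ?nnegrE ?oC// (le_trans _ (oC _ Ox)).
Qed.

Lemma smooth_L2form k omega : smooth_form omega -> kform k omega -> L2form Omega k omega.
Proof.
move=> so ko; apply: bounded_L2form => // A.
  by apply: measurable_funTS; exact: measurable_fun_continuous_rV (smooth_continuous (so A)).
exact: continuous_bounded (smooth_continuous (so A)).
Qed.

Lemma smooth_extd p : smooth_form p -> smooth_form (extd p).
Proof.
move=> sp B; rewrite (_ : extd p ^~ B = fun x =>
    \sum_(i in B) (-1) ^+ before i B * partial i (p ^~ (B :\ i)) x).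
  by apply: smooth_sum => i _; apply: smoothZ; exact: smooth_partial.
by apply/funext => x; rewrite extdE.
Qed.

Lemma smooth_codiff k phi : smooth_form phi -> kform k.+1 phi ->
  smooth_form (codiff k.+1 phi).
Proof.
move=> sp kp A; rewrite (_ : _ ^~ A = fun x => (-1) * 
    \sum_(i | i \notin A) (-1) ^+ before i A * partial i (phi ^~ (i |: A)) x).
  apply: smoothZ; apply: smooth_sum => i _; apply: smoothZ; exact: smooth_partial.
by apply/funext => x; rewrite codiffE// mulN1r.
Qed.

Lemma kform_codiff k phi : smooth_form phi -> kform k.+1 phi -> kform k (codiff k.+1 phi).
Proof.
move=> sp kp x A Ak; rewrite codiffE// big1 ?oppr0// => i iA.
rewrite (_ : _ ^~ _ = cst 0) ?partial_cst ?mulr0//.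
by apply/funext => y; rewrite kp// card_setU1N.
Qed.

Lemma dotfC omega eta : dotf omega eta = dotf eta omega.
Proof. by apply/funext => x; apply: eq_bigr => A _; rewrite mulrC. Qed.

Lemma dotL2C omega eta : dotL2 Omega omega eta = dotL2 Omega eta omega.
Proof. by rewrite /dotL2 dotfC. Qed.

Lemma dot0L2 eta : dotL2 Omega 0 eta = 0.
Proof.
rewrite -[RHS](integral_rV0 Omega); apply: eq_integral_rV => x _.
by rewrite /dotf big1// => A _; rewrite mul0r.
Qed.

Lemma integral_rV_support D f : D `<=` Omega -> (forall x, Omega x -> ~ D x -> f x = 0) ->
  integral_rV Omega f = integral_rV D f.
Proof.
move=> DO f0; rewrite /integral_rV Rintegral_mkcond [RHS]Rintegral_mkcond.
congr (Rintegral _ _ _); apply/funext => t; rewrite !patchE.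
have [Dt|nDt] := pselect (D (rV_of_tuple t)).
  by rewrite !mem_set//; exact: DO.
rewrite [in RHS]memNset//; have [Ot|nOt] := pselect (Omega (rV_of_tuple t)).
  by rewrite mem_set// f0.
by rewrite memNset.
Qed.

End square_integrable.

(** * Weak derivatives inside a cell *)

Section exhaustion.
Variables (R : realType) (n : nat) (T : {fset 'rV[R]_n}).
Variables (v a : 'I_n.+1 -> 'rV[R]_n) (b : 'I_n.+1 -> R).
Hypothesis bT : barycentric T v a b.
Implicit Types (m : nat) (x : 'rV[R]_n).
Let lam i := affine (a i) (b i).

(** A cut-off supported where all barycentric coordinates are at least 1/(m+1);
    it tends to 1 on the open cell as m grows. *)
Definition bump m x : R :=
  \prod_(i < n.+1) flat 0 (affine (m.+1%:R *: a i) (m.+1%:R * b i - 1) x).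

Lemma bump_arg m i x :
  affine (m.+1%:R *: a i) (m.+1%:R * b i - 1) x = m.+1%:R * lam i x - 1.
Proof.
rewrite /lam /affine mulrDr addrAC; congr (_ + _ - 1); rewrite mulr_sumr.
by apply: eq_bigr => j _; rewrite mxE mulrA.
Qed.

Lemma smooth_bump m : smooth (bump m).
Proof. by apply: smooth_prod => i; exact: smooth_flat_affine. Qed.

Lemma flat0_le1 (s : R) : flat 0 s <= 1.
Proof.
rewrite /flat; case: ifP => // s0; rewrite expr0 mul1r.
by rewrite -expR0 ler_expR oppr_le0 invr_ge0 ltW.
Qed.

Lemma bump_itv m x : 0 <= bump m x <= 1.
Proof.
apply/andP; split; first by apply: prodr_ge0 => i _; exact: flat_ge0.
by apply: prodr_ile1 => i _; rewrite flat_ge0 flat0_le1.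
Qed.

Lemma bump_neq0 m x : bump m x != 0 -> forall i, m.+1%:R^-1 <= lam i x.
Proof.
move=> + i; apply: contraNT; rewrite -ltNge => lx.
rewrite /bump (bigD1 i)//= bump_arg /flat ifF ?mul0r//.
apply/negbTE; rewrite -leNgt subr_le0 -ler_pdivlMl ?ltr0n// mulr1.
exact: ltW.
Qed.

Lemma cvg_flat0 (u : R) : 0 < u -> (fun m => flat 0 (m.+1%:R * u - 1)) @ \oo --> (1 : R).
Proof.
move=> u0; apply/cvgrPdist_le => e e0; near=> m.
have mu : e^-1 + 1 <= m.+1%:R * u.
  rewrite -ler_pdivrMr//; near: m.
  exists (Num.bound ((e^-1 + 1) / u)) => // m /= bm.
  apply: le_trans (ltW (archi_boundP _)) _.
    by rewrite divr_ge0 ?addr_ge0 ?invr_ge0 ?ltW.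
  by rewrite ler_nat; exact: leq_trans bm _.
have ei : 0 < e^-1 by rewrite invr_gt0.
rewrite ger0_norm ?subr_ge0 ?flat0_le1//.
rewrite /flat ifT; last by rewrite subr_gt0; lra.
rewrite expr0 mul1r.
have := expR_ge1Dx (- (m.+1%:R * u - 1)^-1).
have : (m.+1%:R * u - 1)^-1 <= e.
  by rewrite -[leRHS]invrK lef_pV2 ?posrE//; lra.
lra.
Unshelve. all: by end_near. Qed.

Lemma cvg_bump x : (forall i, 0 < lam i x) -> (fun m => bump m x) @ \oo --> (1 : R).
Proof.
move=> l0; rewrite /bump.
have h (r : seq 'I_n.+1) : (fun m => \prod_(i <- r)
    flat 0 (affine (m.+1%:R *: a i) (m.+1%:R * b i - 1) x)) @ \oo --> (1 : R).
  elim: r => [|i r IH].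
    by under eq_fun do rewrite big_nil; exact: cvg_cst.
  pose f m := flat 0 (m.+1%:R * lam i x - 1) *
    \prod_(i <- r) flat 0 (affine (m.+1%:R *: a i) (m.+1%:R * b i - 1) x).
  have fE : (fun m => \prod_(i <- i :: r)
      flat 0 (affine (m.+1%:R *: a i) (m.+1%:R * b i - 1) x)) = f.
    by apply/funext => m; rewrite big_cons bump_arg.
  have h : f @ \oo --> (1 * 1 : R) by apply: cvgM IH; exact: cvg_flat0 (l0 i).
  have e1 : 1 * 1 = 1 :> R by rewrite mulr1.
  by rewrite fE; rewrite e1 in h.
exact: h.
Qed.

Lemma bump_support_closed m : closed [set x | forall i, m.+1%:R^-1 <= lam i x].
Proof.
rewrite (_ : [set _ | _] = \bigcap_i (lam i @^-1` [set t | m.+1%:R^-1 <= t])).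
  apply: closed_bigI => i _; apply: closed_comp; last exact: closed_ge.
  by move=> x _; exact: continuous_affine.
by apply/seteqP; split => x /= h i; [move=> _; exact: h|exact: h].
Qed.

Lemma bump_support_cell m x : (forall i, m.+1%:R^-1 <= lam i x) -> interior (hull T) x.
Proof.
by move=> h; rewrite (bary_interior bT) => i /=; apply: lt_le_trans (h i); rewrite invr_gt0.
Qed.

End exhaustion.

Lemma compact_box_bounded (R : realType) n (A : set 'rV[R]_n) :
  closed A -> box_bounded A -> compact A.
Proof.
move=> cA [M AM].
apply: (@subclosed_compact _ A [set v : 'rV[R]_n | forall i, v ord0 i \in `[(- M), M]]) => //.
  by apply: (@rV_compact _  _ (fun=> `[(- M), M]%classic)) => _; exact: segment_compact.
by move=> x /AM xM i; rewrite in_itv/= -ler_norml ltW.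
Qed.

Section weak_derivative_on_cells.
Variables (R : realType) (n : nat) (Omega : set 'rV[R]_n) (G : {fset {fset 'rV[R]_n}}).
Hypothesis oOmega : open Omega.
Hypothesis regular : interior (closure Omega) = Omega.
Hypothesis subdiv : simplicial_subdivision Omega G.
Implicit Types (omega eta tau phi p : dform R n) (A B : {set 'I_n}) (k : nat).
Local Notation pre D := (@rV_of_tuple R n @^-1` D).

(** Dominated convergence, with the absolute value of g as the dominating
    function. *)
Lemma integral_rV_eq0_exhaustion (D : set 'rV[R]_n) (psi : nat -> 'rV[R]_n -> R) g :
  measurable (pre D) -> (forall m, continuous (psi m)) -> (forall m x, 0 <= psi m x <= 1) ->
  (forall x, D x -> (fun m => psi m x) @ \oo --> (1 : R)) ->
  integrable_rV D g -> (forall m, integral_rV D (fun x => psi m x * g x) = 0) ->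
  integral_rV D g = 0.
Proof.
move=> mD cpsi psi01 psi1 ig int0.
have mg := measurable_int _ ig.
have mpg m : measurable_fun (pre D) (fun t => (psi m (rV_of_tuple t) * g (rV_of_tuple t))%:E).
  apply/measurable_EFinP; apply: measurable_funM; last exact/measurable_EFinP.
  by apply: measurable_funTS; exact: measurable_fun_continuous_rV (cpsi m).
have ipg m : integrable_rV D (fun x => psi m x * g x).
  apply: le_integrable ig => // t _ /=; rewrite lee_fin normrM ler_piMl//.
  by have /andP[p0 p1] := psi01 m (rV_of_tuple t); rewrite ger0_norm.
have zero m : (\int[lebesgue_tuple R n]_(t in pre D)
    (psi m (rV_of_tuple t) * g (rV_of_tuple t))%:E = 0)%E.
  have := int0 m; rewrite /integral_rV /Rintegral => h.
  rewrite -[LHS]fineK ?h//; exact: (integrable_fin_num mD (ipg m)).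
pose f m t := (psi m (rV_of_tuple t) * g (rV_of_tuple t))%:E.
have fcvg t : pre D t -> f ^~ t @ \oo --> (g (rV_of_tuple t))%:E.
  move=> Dt; apply/cvg_EFin; first exact: nearW.
  have h : (fun m => psi m (rV_of_tuple t) * g (rV_of_tuple t)) @ \oo -->
      1 * g (rV_of_tuple t) by apply: cvgM; [exact: psi1|exact: cvg_cst].
  by rewrite mul1r in h.
have fdom t m : pre D t -> (`|f m t| <= `|(g (rV_of_tuple t))%:E|)%E.
  move=> Dt; rewrite /f /= lee_fin normrM ler_piMl//.
  by have /andP[p0 p1] := psi01 m (rV_of_tuple t); rewrite ger0_norm.
have [_ _] := @dominated_convergence _ _ _ (lebesgue_tuple R n) (pre D) mD f _ _ mpg mg
   (aeW _ fcvg) (integrable_abse ig) (aeW _ fdom).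
rewrite (_ : [sequence _]_m = cst 0%E); last by apply/funext => m; exact: zero.
move=> /(cvg_lim (@ereal_hausdorff R)); rewrite lim_cst; last exact: ereal_hausdorff.
by rewrite /integral_rV /Rintegral => <-.
Qed.

Lemma test_form_smooth k phi : test_form Omega k phi -> smooth_form phi /\ kform k phi.
Proof. by move=> [kp sp _ _]; split. Qed.

Lemma codiff_eq0_open k phi U x : smooth_form phi -> kform k.+1 phi -> open U -> U x ->
  (forall y, U y -> phi y = fun=> 0) -> codiff k.+1 phi x = fun=> 0.
Proof.
move=> sp kp oU Ux p0; apply/funext => A; rewrite codiffE// big1 ?oppr0// => i iA.
by rewrite (partial_eq0_open i oU Ux) ?mulr0// => y Uy; rewrite p0.
Qed.

Lemma integral_cell_partial T f i : T \in G -> smooth f ->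
  (exists2 K, closed K & K `<=` cell T /\ (forall x, ~ K x -> f x = 0)) ->
  integrable_rV (cell T) (partial i f) /\ integral_rV (cell T) (partial i f) = 0.
Proof.
move=> TG sf [K cK [KT fK]].
have [M cM] := box_bounded_cell (mesh_simplex subdiv TG).
have fM x : f x != 0 -> forall j, `|x ord0 j| < M.
  move=> fx; apply: cM; apply: KT; apply: contrapT => /fK e.
  by move: fx; rewrite e eqxx.
have [ip intp] := integral_partial i sf fM.
split; first by apply: integrableS ip => //; exact: measurable_cell.
transitivity (integral_rV setT (partial i f)).
  apply/esym/integral_rV_support => // x _ xT.
  apply: (@partial_eq0_open _ _ (~` K)); first exact: closed_openC.
    by move/KT.
  by move=> y; exact: fK.
by rewrite /integral_rV /Rintegral preimage_setT intp.
Qed.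

(** Test the weak derivative with the cut-off form bump_m eta, which is supported
    in a compact subset of the cell.  Integration by parts shows that dtau and
    the classical derivative of p have the same integral against it, and the
    cut-offs are removed in the limit.  Thus eta need not vanish on the boundary
    of the cell. *)
Lemma weak_extd_cell T k tau dtau p eta : T \in G -> weak_extd Omega k tau dtau ->
  smooth_form p -> (forall x, cell T x -> tau x = p x) ->
  smooth_form eta -> kform k.+1 eta ->
  integral_rV (cell T) (dotf dtau eta) = integral_rV (cell T) (dotf (extd p) eta).
Proof.
move=> TG [L2t L2dt weak] sp tp se ke.
have sT := mesh_simplex subdiv TG.
have [v [a [b bT]]] := simplex_barycentric sT.
have cO := cell_sub regular subdiv TG.
have bO := box_bounded_Omega subdiv.
have mT : measurable (pre (cell T)) by exact: measurable_cell.
have L2e : L2form Omega k.+1 eta by exact: smooth_L2form.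
have ig : integrable_rV (cell T) (dotf dtau eta).
  apply: integrableS (dotf_integrable oOmega L2dt L2e) => //; first exact: measurable_Omega.
  by move=> t; exact: cO.
have smooth_dot q r : smooth_form q -> smooth_form r -> smooth (dotf q r).
  by move=> sq sr; apply: smooth_sum => A _; exact: smoothM.
have icell f : smooth f -> integrable_rV (cell T) f.
  move=> sf; apply: continuous_integrable_rV => //; first exact: box_bounded_cell.
  exact: smooth_continuous.
have sdp := smooth_extd sp.
have ih : integrable_rV (cell T) (dotf (extd p) eta) by exact/icell/smooth_dot.
apply/eqP; rewrite -subr_eq0 -integral_rVB//; apply/eqP.
apply: (@integral_rV_eq0_exhaustion _ (bump a b)) => //.
- by move=> m; apply: smooth_continuous; exact: smooth_bump.
- by move=> m x; exact: bump_itv.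
- by move=> x; rewrite /cell (bary_interior bT); exact: cvg_bump.
- exact: integrable_rVB.
move=> m.
pose phi : dform R n := fun x A => bump a b m x * eta x A.
pose K := [set x | forall i, m.+1%:R^-1 <= affine (a i) (b i) x].
have cK : closed K by exact: bump_support_closed.
have KT : K `<=` cell T by move=> x; exact: (bump_support_cell bT).
have phiK x A : ~ K x -> phi x A = 0.
  move=> xK; rewrite /phi; have [->|h] := eqVneq (bump a b m x) 0; first by rewrite mul0r.
  by exfalso; apply: xK; exact: bump_neq0 h.
have sphi : smooth_form phi by move=> A; apply: smoothM => //; exact: smooth_bump.
have kphi : kform k.+1 phi by move=> x A Ak; rewrite /phi ke// mulr0.
have tphi : test_form Omega k.+1 phi.
  have subK : closure [set x | exists A, phi x A != 0] `<=` K.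
    rewrite [X in _ `<=` X]((closure_id K).1 cK); apply: closure_subset.
    move=> x [A pA]; apply: contrapT => /phiK e; by move: pA; rewrite e eqxx.
  split => //.
    apply: compact_box_bounded; first exact: closed_closure.
    have [M hM] := box_bounded_cell sT.
    by exists M => x /subK/KT; exact: hM.
  by move=> x /subK/KT/cO.
have e1 : integral_rV (cell T) (fun x => bump a b m x * dotf dtau eta x) =
    dotL2 Omega dtau phi.
  rewrite /dotL2 (integral_rV_support cO) => [|x _ xT]; last first.
    by rewrite /dotf big1// => A _; rewrite phiK ?mulr0//; move/KT.
  apply: eq_integral_rV => x _; rewrite /dotf mulr_sumr; apply: eq_bigr => A _.
  by rewrite mulrCA.
have e2 : dotL2 Omega tau (codiff k.+1 phi) = integral_rV (cell T) (dotf p (codiff k.+1 phi)).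
  rewrite /dotL2 (integral_rV_support cO) => [|x _ xT]; last first.
    rewrite /dotf (@codiff_eq0_open _ _ (~` K))//; last 3 first.
    - exact: closed_openC.
    - by move/KT.
    - by move=> y yK; apply/funext => A; exact: phiK.
    by rewrite big1// => A _; rewrite mulr0.
  by apply: eq_integral_rV => x xT; rewrite /dotf tp.
have e3 : integral_rV (cell T) (dotf (extd p) phi) =
    integral_rV (cell T) (dotf p (codiff k.+1 phi)).
  have scd := smooth_codiff sphi kphi.
  apply/eqP; rewrite -subr_eq0 -integral_rVB//; try exact/icell/smooth_dot.
  rewrite (eq_integral_rV (fun x _ => dotf_extd_codiff x sp sphi kphi)); apply/eqP.
  have part (A : {set 'I_n}) i : integrable_rV (cell T)
      (fun x => (-1) ^+ before i A * partial i (fun y => p y A * phi y (i |: A)) x) /\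
    integral_rV (cell T)
      (fun x => (-1) ^+ before i A * partial i (fun y => p y A * phi y (i |: A)) x) = 0.
    have [|||ii i0] := @integral_cell_partial T (fun y => p y A * phi y (i |: A)) i => //.
    - exact: smoothM.
    - by exists K => //; split => // x xK; rewrite phiK// mulr0.
    by split; [exact: integrable_rVZ|rewrite integral_rVZ// i0 mulr0].
  rewrite integral_rV_sum// => [|A _].
    rewrite big1// => A _; rewrite integral_rV_sum// => [|i _]; last exact: (part A i).1.
    by rewrite big1// => i _; exact: (part A i).2.
  by apply: integrable_rV_sum => // i _; exact: (part A i).1.
have e4 : integral_rV (cell T) (fun x => bump a b m x * dotf (extd p) eta x) =
    integral_rV (cell T) (dotf (extd p) phi).
  apply: eq_integral_rV => x _; rewrite /dotf mulr_sumr; apply: eq_bigr => A _.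
  by rewrite mulrCA.
have ibump g : integrable_rV (cell T) g -> integrable_rV (cell T) (fun x => bump a b m x * g x).
  move=> ig'; have mg' := measurable_int _ ig'.
  apply: le_integrable ig' => //.
    apply/measurable_EFinP; apply: measurable_funM.
      apply: measurable_funTS; apply: measurable_fun_continuous_rV.
      by apply: smooth_continuous; exact: smooth_bump.
    exact/measurable_EFinP.
  move=> t _ /=; rewrite lee_fin normrM ler_piMl//.
  by have /andP[b0 b1] := bump_itv a b m (rV_of_tuple t); rewrite ger0_norm.
transitivity (integral_rV (cell T) (fun x => bump a b m x * dotf dtau eta x -
    bump a b m x * dotf (extd p) eta x)).
  by apply: eq_integral_rV => x _; rewrite mulrBr.
by rewrite integral_rVB ?e1 ?e4 ?e3 ?weak ?e2 ?subrr//; exact: ibump.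
Qed.

End weak_derivative_on_cells.

(** * Interpolation on a cell and gluing *)

Section discrete_spaces.
Variables (R : realType) (n : nat) (Omega : set 'rV[R]_n) (G : {fset {fset 'rV[R]_n}}).
Hypothesis n_gt0 : (0 < n)%N.
Hypothesis oOmega : open Omega.
Hypothesis regular : interior (closure Omega) = Omega.
Hypothesis subdiv : simplicial_subdivision Omega G.
Implicit Types (omega eta tau phi p mu : dform R n) (A B : {set 'I_n}) (k : nat).
Implicit Types (a b e q : {set 'I_n} -> R) (T : {fset 'rV[R]_n}).
Local Notation pre D := (@rV_of_tuple R n @^-1` D).

Lemma integrable_cell T f : T \in G -> continuous f -> integrable_rV (cell T) f.
Proof.
move=> TG cf; apply: continuous_integrable_rV cf; first exact: measurable_cell.
exact/box_bounded_cell/(mesh_simplex subdiv).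
Qed.

Lemma integral_cell_sum T (I : finType) (P : pred I) (s : I -> R) (F : I -> 'rV[R]_n -> R) :
  T \in G -> (forall i, smooth (F i)) ->
  integral_rV (cell T) (fun x => \sum_(i | P i) s i * F i x) =
  \sum_(i | P i) s i * integral_rV (cell T) (F i).
Proof.
move=> TG sF; have mT := measurable_cell T.
have iF i : integrable_rV (cell T) (F i).
  by apply: integrable_cell => //; exact: smooth_continuous.
rewrite integral_rV_sum// => [|i _]; last exact: integrable_rVZ.
by apply: eq_bigr => i _; rewrite integral_rVZ.
Qed.

Lemma mean0 T : mean T (fun=> 0) = 0.
Proof. by rewrite /mean integral_rV0 mul0r. Qed.

Lemma dotf_koszul c b eta x : dotf (koszul c (fun=> b)) eta x =
  \sum_(A : {set 'I_n}) b A * \sum_(i in A) (-1) ^+ before i A * ((x - c) ord0 i * eta x (A :\ i)).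
Proof.
rewrite /dotf /koszul; under eq_bigr do rewrite mulr_suml.
rewrite exchange_big/=; apply: eq_bigr => A _.
under eq_bigr do rewrite -mulrA mulr_suml.
rewrite -mulr_sumr; congr (_ * _); rewrite exchange_big/=; apply: eq_bigr => i iA.
rewrite (bigD1 (A :\ i))//= big1 ?addr0 => [|B BA]; rewrite /dx.
  by rewrite eqxx mulr1 mulrA.
by rewrite (negbTE BA) mulr0 mul0r.
Qed.

(** With c the barycenter, Koszul forms have mean zero, so the pairing on the left
    only sees the mean of eta and its constant codifferential e.  Taking for e
    the mean of delta phi matches the constant part of p.  Matching the Koszul
    part determines the mean of eta: from the mean of phi one subtracts
    1/(k+1) times the mean of the form adjoint to kappa_c applied to
    delta phi. *)
Lemma cell_interpolant T k phi : T \in G -> (k < n)%N ->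
  smooth_form phi -> kform k.+1 phi ->
  exists eta e,
    [/\ P1starminus k.+1 eta, smooth_form eta, kform k.+1 eta, homogeneous k e &
        forall x, codiff k.+1 eta x = e] /\
    forall a b, homogeneous k a -> homogeneous k.+1 b ->
      let p := whitney (barycenter T) a b in
      integral_rV (cell T) (dotf (extd p) eta) - integral_rV (cell T) (dotf p (fun=> e)) =
      integral_rV (cell T) (dotf (extd p) phi) -
        integral_rV (cell T) (dotf p (codiff k.+1 phi)).
Proof.
move=> TG kn sphi kphi; have sT := mesh_simplex subdiv TG.
pose c := barycenter T; pose d := codiff k.+1 phi.
have sd : smooth_form d by exact: smooth_codiff.
have kd : kform k d by exact: kform_codiff.
pose V := integral_rV (cell T) (fun=> 1).
pose e A := mean T (d ^~ A).
(* The adjoint of kappa_c applied to d = delta phi. *)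
pose u A x := \sum_(i in A) (-1) ^+ before i A * ((x - c) ord0 i * d x (A :\ i)).
have su A : smooth (u A).
  apply: smooth_sum => i _; apply: smoothZ; apply: smoothM => //; exact: smooth_coord.
pose q A := mean T (phi ^~ A) - #|A|%:R^-1 * mean T (u A).
have he : homogeneous k e.
  move=> A Ak; rewrite /e (_ : _ ^~ A = fun=> 0) ?mean0//.
  by apply/funext => x; exact: kd.
have hq : homogeneous k.+1 q.
  move=> A Ak; rewrite /q (_ : _ ^~ A = fun=> 0); last by apply/funext => x; exact: kphi.
  rewrite (_ : u A = fun=> 0) ?mean0 ?mulr0 ?subr0//.
  apply/funext => x; rewrite /u big1// => i iA; rewrite kd ?mulr0//.
  by apply: contraNneq Ak => <-; rewrite (cardsD1 i) iA.
have Ve A : e A * V = integral_rV (cell T) (d ^~ A).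
  by apply: mean_cell => //; exact: smooth_continuous.
have Vq A : q A * V = integral_rV (cell T) (phi ^~ A) -
    #|A|%:R^-1 * integral_rV (cell T) (u A).
  rewrite /q mulrBl -[X in _ - X]mulrA.
  by congr (_ - _ * _); apply: mean_cell => //; exact: smooth_continuous.
have [eta [Pe se ke de [l etal]]] := P1starminus_exists c kn hq he.
exists eta, e; split; first by split => // x; apply/funext => A; exact: de.
move=> a b ha hb p.
have sp : smooth_form p by exact: smooth_whitney.
have coord0 s : integral_rV (cell T) (fun x => \sum_i s i * (x - c) ord0 i) = 0.
  rewrite integral_cell_sum// => [|i]; last exact: smooth_coord.
  by rewrite big1// => i _; rewrite integral_barycenter// mulr0.
have scoord s : smooth (fun x : 'rV[R]_n => \sum_i s i * (x - c) ord0 i).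
  by apply: smooth_sum => i _; apply: smoothZ; exact: smooth_coord.
have intcst (z : R) : integral_rV (cell T) (fun=> z) = z * V.
  rewrite -integral_rVZ; [|exact: measurable_cell|]; last first.
    by apply: integrable_cell => //; exact: cst_continuous.
  by apply: eq_integral_rV => x _; rewrite mulr1.
have Veta A : integral_rV (cell T) (eta ^~ A) = q A * V.
  rewrite (eq_integral_rV (fun x _ => etal x A)) integral_rVD.
  - by rewrite intcst coord0 addr0.
  - exact: measurable_cell.
  - by apply: integrable_cell => //; exact: cst_continuous.
  - by apply: integrable_cell => //; apply: smooth_continuous; exact: scoord.
have dpE r : smooth_form r -> integral_rV (cell T) (dotf (extd p) r) =
    \sum_(A : {set 'I_n}) (#|A|%:R * b A) * integral_rV (cell T) (r ^~ A).
  move=> sr; rewrite -integral_cell_sum//; apply: eq_integral_rV => x _.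
  by apply: eq_bigr => A _; rewrite extd_whitney.
have skosz A : smooth (koszul c (fun=> b) ^~ A) by exact: smooth_koszul.
have pE r : smooth_form r -> integral_rV (cell T) (dotf p r) =
    \sum_(A : {set 'I_n}) a A * integral_rV (cell T) (r ^~ A) +
    integral_rV (cell T) (dotf (koszul c (fun=> b)) r).
  move=> sr; rewrite -integral_cell_sum// -integral_rVD.
  - apply: eq_integral_rV => x _; rewrite -big_split; apply: eq_bigr => A _ /=.
    by rewrite mulrDl.
  - exact: measurable_cell.
  - apply: integrable_cell => //; apply: smooth_continuous.
    by apply: smooth_sum => A _; exact: smoothZ.
  - apply: integrable_cell => //; apply: smooth_continuous.
    by apply: smooth_sum => A _; exact: smoothM.
have kd0 : integral_rV (cell T) (dotf (koszul c (fun=> b)) (fun=> e)) = 0.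
  rewrite -[RHS](coord0 (fun i => \sum_(A : {set 'I_n} | i \notin A)
    e A * ((-1) ^+ before i A * b (i |: A)))).
  apply: eq_integral_rV => x _; rewrite /dotf.
  under eq_bigr do rewrite koszulE mulr_suml.
  rewrite (exchange_big_dep predT)//=; apply: eq_bigr => i _; rewrite mulr_suml.
  by apply: eq_bigr => A iA; rewrite mulrC mulrA.
have ku : integral_rV (cell T) (dotf (koszul c (fun=> b)) d) =
    \sum_(A : {set 'I_n}) b A * integral_rV (cell T) (u A).
  rewrite -(integral_cell_sum xpredT b TG su).
  by apply: eq_integral_rV => x _; rewrite dotf_koszul.
rewrite (dpE _ se) (dpE _ sphi) (pE _ sd) (pE (fun=> e) (fun A => smooth_cst (e A))).
rewrite kd0 ku addr0 opprD addrA [RHS]addrAC -!sumrB; apply: eq_bigr => A _.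
rewrite Veta Vq intcst Ve mulrBr [X in _ - X - _](_ : _ = b A * integral_rV (cell T) (u A))//.
have [Ak|Ak] := eqVneq #|A| k.+1; last by rewrite hb// mulr0 !mul0r.
by rewrite Ak mulrA [_ * b A * _]mulrAC divff ?mul1r// pnatr_eq0.
Qed.

(** Cells are disjoint, so at most one term of the sum is nonzero; the sum makes
    measurability immediate. *)
Definition glue (F : {fset 'rV[R]_n} -> dform R n) : dform R n := fun x A =>
  \sum_(T <- G) (`[< cell T x >])%:R * F T x A.

Lemma glueE F T x : T \in G -> cell T x -> glue F x = F T x.
Proof.
move=> TG Tx; apply/funext => A; rewrite /glue (bigD1_seq T) ?fset_uniq//=.
rewrite asboolT// mul1r big_seq_cond big1 ?addr0// => S /andP[SG ST].
rewrite asboolF ?mul0r// => Sx; move: ST.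
by rewrite (cell_disjoint subdiv SG TG Sx Tx) eqxx.
Qed.

Lemma glue_out F x : ~ cells G x -> glue F x = fun=> 0.
Proof.
move=> nx; apply/funext => A; rewrite /glue big_seq big1// => T TG.
by rewrite asboolF ?mul0r// => Tx; apply: nx; exists T.
Qed.

Lemma L2form_glue k F : (forall T, smooth_form (F T)) -> (forall T, kform k (F T)) ->
  L2form Omega k (glue F).
Proof.
move=> sF kF; have bO := box_bounded_Omega subdiv.
apply: bounded_L2form => //.
- by move=> x A Ak; rewrite /glue big1// => T _; rewrite kF// mulr0.
- move=> A; rewrite /glue; apply: measurable_sum => T.
  apply: measurable_funM.
    rewrite (_ : (fun _ => _) = \1_(pre (cell T))).
      by apply: measurable_indic; exact: measurable_cell.
    apply/funext => t; rewrite indicE.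
    have [Tt|nTt] := pselect (cell T (rV_of_tuple t)).
      by rewrite asboolT// mem_set.
    by rewrite asboolF// memNset.
  apply: measurable_funTS.
  exact: (measurable_fun_continuous_rV (smooth_continuous (sF T A))).
- move=> A; rewrite /glue.
  elim: (enum_fset G) => [|T r [C hC]]; first by exists 0 => x _; rewrite big_nil normr0.
  have [D hD] := continuous_bounded bO (smooth_continuous (sF T A)).
  exists (D + C) => x Ox; rewrite big_cons; apply: le_trans (ler_normD _ _) _.
  apply: lerD; last exact: hC.
  apply: le_trans (hD _ Ox); rewrite normrM ler_piMl//.
  by case: asboolP => _; rewrite ?normr1// normr0.
Qed.

Lemma extd_near mu p (U : set 'rV[R]_n) x : open U -> U x ->
  (forall y, U y -> mu y = p y) -> extd mu x = extd p x.
Proof.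
move=> oU Ux mp; apply/funext => B; rewrite !extdE; apply: eq_bigr => i iB.
congr (_ * _); apply: partial_near; near=> y; rewrite mp//.
by near: y; exact: open_nbhs_nbhs.
Unshelve. all: by end_near. Qed.

Lemma codiff_near k mu p (U : set 'rV[R]_n) x : open U -> U x ->
  (forall y, U y -> mu y = p y) -> codiff k mu x = codiff k p x.
Proof.
move=> oU Ux mp; apply/funext => A; rewrite /codiff; congr (_ * _); rewrite !hodgeE.
congr (_ * _); have := extd_near (mu := hodge mu) (p := hodge p) oU Ux.
move=> ->// y Uy; apply/funext => B; rewrite !hodgeE mp//.
Qed.

Lemma cells_cell T x : T \in G -> cell T x -> cells G x.
Proof. by move=> TG Tx; exists T. Qed.

Lemma codiff_hE k mu T x : T \in G -> cell T x -> codiff_h G k mu x = codiff k mu x.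
Proof.
by move=> TG Tx; rewrite /codiff_h patchE mem_set//; exact: cells_cell Tx.
Qed.

Lemma patch_cells_eq0 (D : dform R n) :
  (forall T x, T \in G -> cell T x -> D x = fun=> 0) -> patch (fun=> 0) (cells G) D = 0.
Proof.
move=> D0; apply/funext => x; rewrite patchE; case: ifPn => //.
by rewrite inE => -[T TG Tx]; rewrite (D0 T).
Qed.

Lemma extd_cst a x : extd (fun=> a) x = fun=> 0.
Proof.
apply/funext => B; rewrite extdE big1// => i _.
by rewrite (partial_cst (a _)) mulr0.
Qed.

Lemma codiff_cst k a x : codiff k (fun=> a) x = fun=> 0.
Proof.
apply/funext => A; rewrite /codiff hodgeE (_ : hodge (fun=> a) = fun=> hodge (fun=> a) 0).
  by rewrite extd_cst !mulr0.
by apply/funext => y; apply/funext => B; rewrite !hodgeE.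
Qed.

Lemma dotL2_mesh k l omega eta : L2form Omega k omega -> L2form Omega l eta ->
  dotL2 Omega omega eta = \sum_(T <- G) integral_rV (cell T) (dotf omega eta).
Proof.
move=> ho he; apply: integral_mesh => //; exact: dotf_integrable ho he.
Qed.

Lemma Wh_whitney_on_cell k tau T : Wh Omega G k tau -> T \in G ->
  exists a b, [/\ homogeneous k a, homogeneous k.+1 b &
    forall x, cell T x -> tau x = whitney (barycenter T) a b x].
Proof.
move=> [[_ pw] _] TG; have [p Pp tp] := pw T TG.
have [a [b [ha hb pE]]] := (whitneyP k (barycenter T) p).1 Pp.
by exists a, b; split => // x Tx; rewrite tp// pE.
Qed.

End discrete_spaces.

(** * Discrete harmonic forms *)

Section harmonic.
Variables (R : realType) (n k : nat) (Omega : set 'rV[R]_n) (G : {fset {fset 'rV[R]_n}}).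
Hypothesis kn : (0 < k < n)%N.
Hypothesis oOmega : open Omega.
Hypothesis regular : interior (closure Omega) = Omega.
Hypothesis subdiv : simplicial_subdivision Omega G.
Implicit Types (omega eta tau phi p mu : dform R n) (A B : {set 'I_n}).
Implicit Types (a b e q : {set 'I_n} -> R) (T : {fset 'rV[R]_n}).

Let k_gt0 : (0 < k)%N. Proof. by case/andP: kn. Qed.
Let k_lt : (k < n)%N. Proof. by case/andP: kn. Qed.
Let n_gt0 : (0 < n)%N. Proof. exact: leq_ltn_trans k_lt. Qed.

Lemma patch_cells_eq0_on_cell (D : dform R n) T x :
  patch (fun=> 0) (cells G) D = 0 -> T \in G -> cell T x -> D x = fun=> 0.
Proof.
move=> D0 TG Tx; have := congr1 (@^~ x) D0.
by rewrite patchE mem_set//; exists T.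
Qed.

Lemma Vh_harmonic_cst mu T : Vh Omega G k mu -> extd_h G mu = 0 -> codiff_h G k mu = 0 ->
  T \in G -> exists2 a, homogeneous k a & forall x, cell T x -> mu x = a.
Proof.
move=> [[L2mu pw] _ _] d0 c0 TG; have [p Pp mp] := pw T TG.
have sT := mesh_simplex subdiv TG; have [x0 Tx0] := cell_neq0 sT.
have oT := @open_cell _ _ T.
have [||a ha pa] := Pddelta_harmonic_cst kn Pp oT Tx0.
- by move=> x Tx; rewrite -(extd_near oT Tx mp); exact: patch_cells_eq0_on_cell d0 TG Tx.
- by move=> x Tx; rewrite -(codiff_near k oT Tx mp); exact: patch_cells_eq0_on_cell c0 TG Tx.
by exists a => // x Tx; rewrite mp// pa.
Qed.

(** Pairing the classical derivative (k+1) b with the constant form b itself gives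
    (k+1) |b|^2 vol(T) = 0. *)
Lemma weak_closed_cst mu T : Wh Omega G k mu -> weak_extd Omega k mu 0 -> T \in G ->
  exists2 a, homogeneous k a & forall x, cell T x -> mu x = a.
Proof.
move=> Wmu wmu TG; have [a [b [ha hb mab]]] := Wh_whitney_on_cell Wmu TG.
have sT := mesh_simplex subdiv TG.
have kb : kform k.+1 ((fun=> b) : dform R n) by exact: (kform_cst _ _).1 hb.
have sb : smooth_form ((fun=> b) : dform R n) by move=> A; exact: smooth_cst.
have := weak_extd_cell oOmega regular subdiv TG wmu
  (smooth_whitney _ a b) mab sb kb.
have -> : dotf (0 : dform R n) (fun=> b) = fun=> 0.
  by apply/funext => x; rewrite /dotf big1// => A _; rewrite mul0r.
rewrite integral_rV0.
have -> : dotf (extd (whitney (barycenter T) a b)) (fun=> b) =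
    fun=> (k.+1%:R * \sum_(A : {set 'I_n}) b A ^+ 2) * 1.
  apply/funext => x; rewrite mulr1 mulr_sumr; apply: eq_bigr => A _.
  rewrite extd_whitney; have [->|Ak] := eqVneq #|A| k.+1; first by rewrite -mulrA.
  by rewrite hb// !(mulr0, expr0n).
rewrite integral_rVZ; last first.
- by apply: (integrable_cell subdiv TG); exact: cst_continuous.
- exact: measurable_cell.
move=> /esym/eqP; rewrite !mulf_eq0 (gt_eqF (cell_volume_gt0 sT)) orbF pnatr_eq0/=.
rewrite psumr_eq0 => [|A _]; last exact: sqr_ge0.
move=> /allP b0; exists a => // x Tx; rewrite mab// (_ : b = fun=> 0) ?whitney_cst//.
apply/funext => A; apply/eqP; rewrite -sqrf_eq0; apply: b0; exact: mem_index_enum.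
Qed.

Lemma cst_P1minus a : homogeneous k a -> P1minus k (fun=> a).
Proof.
move=> ha; apply/(whitneyP k 0); exists a, (fun=> 0); split => //.
by rewrite whitney_cst.
Qed.

Lemma cst_Pddelta a T : homogeneous k a -> Pddelta T k (fun=> a).
Proof.
move=> ha; exists (fun=> a), (fun=> fun=> 0), (fun=> fun=> 0), (fun=> 0); split.
- by split; [exact: (kform_cst _ _).1 ha|exists a].
- by split => //; exists (fun=> 0).
- by split => //; exists (fun=> 0).
apply/funext => x; apply/funext => A.
transitivity (a A + koszul (barycenter T) (fun=> fun=> 0) x A +
  koszul_delta T (fun=> fun=> 0) x A +
  \sum_(B : {set 'I_n} | #|B| == k) 0 * mu_d_delta T k B x A) => //.
rewrite big1 => [|B _]; last by rewrite mul0r.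
rewrite koszul_deltaE !koszulE !big1 ?mulr0 ?addr0// => i _.
  by rewrite !(mulr0, mul0r).
by rewrite !(mulr0, mul0r).
Qed.

(** The condition against the star space holds because mu is itself an admissible
    tau, with derivative 0, in the definition of that space. *)
Lemma harmonic_sub_Vh mu : harmonic_h Omega G k mu ->
  [/\ Vh Omega G k mu, extd_h G mu = 0 & codiff_h G k mu = 0].
Proof.
move=> [Wmu wmu orth].
have cst T := weak_closed_cst Wmu wmu (T := T).
have d0 : extd_h G mu = 0.
  apply: patch_cells_eq0 => T x TG Tx; have [a ha ma] := cst T TG.
  by rewrite (extd_near (@open_cell _ _ T) Tx ma) extd_cst.
have c0 : codiff_h G k mu = 0.
  apply: patch_cells_eq0 => T x TG Tx; have [a ha ma] := cst T TG.
  by rewrite (codiff_near k (@open_cell _ _ T) Tx ma) codiff_cst.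
split => //; split.
- split; first by case: wmu.
  move=> T TG; have [a ha ma] := cst T TG.
  by exists (fun=> a) => //; exact: cst_Pddelta.
- move=> eta [_ weta]; rewrite d0 dot0L2 dotL2C (weta mu 0)//.
  by rewrite dotL2C dot0L2.
- by move=> tau dtau Wtau wtau; rewrite c0 dot0L2 (orth tau).
Qed.

(** The glued interpolants of phi are tested by tau in [Wh] exactly as phi is, cell
    by cell, and phi passes the test by definition of the weak derivative.  The
    last clause is the interpolation identity for constant p. *)
Lemma star_interpolant phi : test_form Omega k.+1 phi ->
  exists eta, Wh_star_nc Omega G k.+1 eta /\
    forall mu, L2form Omega k mu ->
      (forall T, T \in G -> exists2 a, homogeneous k a & forall x, cell T x -> mu x = a) ->
      dotL2 Omega mu (codiff_h G k.+1 eta) = dotL2 Omega mu (codiff k.+1 phi).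
Proof.
move=> tphi; have [sphi kphi] := test_form_smooth tphi.
have scd := smooth_codiff sphi kphi; have kcd := kform_codiff sphi kphi.
have bO := box_bounded_Omega subdiv.
have L2phi : L2form Omega k.+1 phi by exact: smooth_L2form.
have L2cd : L2form Omega k (codiff k.+1 phi) by exact: smooth_L2form.
(* At simplices outside the mesh the form 0 is chosen, which is smooth. *)
have /choice[F FP] : forall T, exists ye : dform R n * ({set 'I_n} -> R),
    [/\ smooth_form ye.1, kform k.+1 ye.1, homogeneous k ye.2 &
     T \in G -> [/\ P1starminus k.+1 ye.1, (forall x, codiff k.+1 ye.1 x = ye.2) &
      forall a b, homogeneous k a -> homogeneous k.+1 b ->
      let p := whitney (barycenter T) a b in
      integral_rV (cell T) (dotf (extd p) ye.1) - integral_rV (cell T) (dotf p (fun=> ye.2)) =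
      integral_rV (cell T) (dotf (extd p) phi) -
        integral_rV (cell T) (dotf p (codiff k.+1 phi))]].
  move=> T; have [TG|TG] := boolP (T \in G); last first.
    by exists (fun=> fun=> 0, fun=> 0); split; [move=> A; exact: smooth_cst| | |].
  have [y [e [[Py sy ky he cy] id]]] :=
    cell_interpolant n_gt0 subdiv TG k_lt sphi kphi.
  by exists (y, e); split.
pose eta := glue G (fun T => (F T).1).
pose deta := glue G (fun T => fun=> (F T).2).
have L2eta : L2form Omega k.+1 eta.
  by apply: (L2form_glue oOmega subdiv) => T; case: (FP T).
have L2deta : L2form Omega k deta.
  apply: (L2form_glue oOmega subdiv) => T; first by move=> A; exact: smooth_cst.
  by apply: (kform_cst _ _).1; case: (FP T).
have etaE T x : T \in G -> cell T x -> eta x = (F T).1 x by exact: (glueE subdiv).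
have cdE : codiff_h G k.+1 eta = deta.
  apply/funext => x; have [[T TG Tx]|nx] := pselect (cells G x); last first.
    by rewrite /codiff_h patchE memNset// /deta glue_out.
  rewrite (codiff_hE k.+1 eta TG Tx) /deta (glueE subdiv _ TG Tx).
  rewrite (codiff_near k.+1 (@open_cell _ _ T) Tx (fun y Ty => etaE T y TG Ty)).
  by have [_ _ _ /(_ TG)[_ ->]] := FP T.
have detaE T x : T \in G -> cell T x -> deta x = (F T).2.
  by move=> TG Tx; rewrite /deta (glueE subdiv _ TG Tx).
exists eta; split.
  split.
    split => // T TG; exists (F T).1; last by move=> x; exact: etaE.
    by have [_ _ _ /(_ TG)[]] := FP T.
  move=> tau dtau Wtau wtau; rewrite cdE.
  have [L2tau L2dtau weak] := wtau.
  have := weak phi tphi; rewrite (dotL2_mesh n_gt0 oOmega regular subdiv L2dtau L2phi).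
  rewrite (dotL2_mesh n_gt0 oOmega regular subdiv L2tau L2cd).
  rewrite (dotL2C _ deta tau) (dotL2_mesh n_gt0 oOmega regular subdiv L2tau L2deta).
  rewrite (dotL2C _ eta dtau) (dotL2_mesh n_gt0 oOmega regular subdiv L2dtau L2eta).
  move=> /eqP; rewrite -subr_eq0 -sumrB => /eqP ws.
  apply/esym/eqP; rewrite -subr_eq0 -sumrB -[X in _ == X]ws; apply/eqP.
  rewrite big_seq [RHS]big_seq; apply: eq_bigr => T TG.
  have [a [b [ha hb tab]]] := Wh_whitney_on_cell Wtau TG.
  have [sy ky he /(_ TG)[_ _ id]] := FP T.
  have sw : smooth_form (whitney (barycenter T) a b) by exact: smooth_whitney.
  have W y := weak_extd_cell oOmega regular subdiv TG wtau sw tab (eta := y).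
  have tw : integral_rV (cell T) (dotf tau (codiff k.+1 phi)) =
      integral_rV (cell T) (dotf (whitney (barycenter T) a b) (codiff k.+1 phi)).
    by apply: eq_integral_rV => x Tx; rewrite /dotf tab.
  rewrite (W phi)// tw.
  rewrite -(id a b ha hb) -(W _ sy ky); congr (_ - _).
    by apply: eq_integral_rV => x Tx; rewrite /dotf (etaE T).
  by apply: eq_integral_rV => x Tx; rewrite /dotf (detaE T)// tab.
move=> mu L2mu cst; rewrite cdE.
rewrite (dotL2_mesh n_gt0 oOmega regular subdiv L2mu L2deta).
rewrite (dotL2_mesh n_gt0 oOmega regular subdiv L2mu L2cd).
rewrite big_seq [RHS]big_seq; apply: eq_bigr => T TG.
have [a ha ma] := cst T TG; have [_ _ _ /(_ TG)[_ _ id]] := FP T.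
have h0 : homogeneous k.+1 ((fun=> 0) : {set 'I_n} -> R) by [].

have := id a (fun=> 0) ha h0; rewrite whitney_cst /=.
have d0 y : integral_rV (cell T) (dotf (extd (fun=> a)) y) = 0.
  rewrite -[RHS](integral_rV0 (cell T)); apply: eq_integral_rV => x _.
  by rewrite /dotf big1// => A _; rewrite extd_cst mul0r.
rewrite !d0 !sub0r => /oppr_inj e.
transitivity (integral_rV (cell T) (dotf (fun=> a) (fun=> (F T).2))).
  by apply: eq_integral_rV => x Tx; rewrite /dotf ma// (detaE T).
by rewrite e; apply: eq_integral_rV => x Tx; rewrite /dotf ma.
Qed.

(** For a test form phi with interpolant eta,
    <mu, delta phi> = <mu, delta_h eta> = <d_h mu, eta> = 0, so mu has weak
    derivative 0. *)
Lemma Vh_sub_harmonic mu : Vh Omega G k mu -> extd_h G mu = 0 -> codiff_h G k mu = 0 ->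
  harmonic_h Omega G k mu.
Proof.
move=> Vmu d0 c0; have [[L2mu _] Vd Vc] := Vmu.
have cst T := Vh_harmonic_cst Vmu d0 c0 (T := T).
have wmu : weak_extd Omega k mu 0.
  split => //.
    apply: (smooth_L2form oOmega (box_bounded_Omega subdiv)) => // A.
    exact: smooth_cst.
  move=> phi tphi; have [eta [Weta id]] := star_interpolant tphi.
  by rewrite dot0L2 -id// -Vd// d0 dot0L2.
split => //.
  split; last by exists 0.
  split => // T TG; have [a ha ma] := cst T TG.
  by exists (fun=> a) => //; exact: cst_P1minus.
by move=> tau dtau Wtau wtau; rewrite -(Vc tau)// c0 dot0L2.
Qed.

End harmonic.

Theorem theorem3p5 (R : realType) (n k : nat)
    (Omega : set 'rV[R]_n) (G : {fset {fset 'rV[R]_n}}) :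
  (2 <= n)%N -> (1 <= k <= n - 1)%N ->
  bounded_lipschitz_domain Omega -> simplicial_subdivision Omega G ->
  [set mu : dform R n | [/\ Vh Omega G k mu, extd_h G mu = 0 &
                           codiff_h G k mu = 0]] = harmonic_h Omega G k.
Proof.
move=> n2 kn1 lip subdiv.
have kn : (0 < k < n)%N by lia.
have oO : open Omega by case: lip.
have reg := interior_closure_lipschitz lip.
apply/seteqP; split => mu.
  by move=> [Vmu d0 c0]; exact: (Vh_sub_harmonic kn oO reg subdiv Vmu d0 c0).
exact: (harmonic_sub_Vh oO reg subdiv).
Qed.
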